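(* Suppose that $r'(t)>0$ for all $t>0$, that $0\le r(t)\le b$ for all $t$, where $b=\sup r(\cdot)$ satisfies $(d-2)<b<2(d-2)$, and that $r(t)/t$ is non-increasing in $t$ for $t>0$. Let $\rho\in(0,1)$ satisfy $\rho\in\left(0,\frac{2(d-2)-b}{2b-2(d-2)}\right]$. Then the multiple shrinkage estimator $\delta_{*a}$ constructed using the rescaled marginal $m_a$ is minimax provided $$a\ge \frac{D}{r^{-1}(d-2)}\left(1+\frac1\rho\right)^2 .$$
   Context: One observes $X\sim N_d(\theta,I_d)$ with unknown $\theta\in\mathbf{R}^d$; estimators $\delta$ are judged by the quadratic risk $R(\theta,\delta)=\mathbf{E}_\theta\|\delta(X)-\theta\|^2$, and $\delta$ is minimax if $\sup_\theta R(\theta,\delta)=\inf_{\delta'}\sup_\theta R(\theta,\delta')$ (this minimax value equals $d$, the constant risk of $\delta_{mle}(X)=X$). Let $m(x)=f(\|x\|^2)$ be the marginal density of $X$ under a spherically symmetric (possibly improper) prior density $\pi(\|\theta\|^2)$ on $\mathbf{R}^d$, i.e. $m(x)=\int (2\pi)^{-d/2}e^{-\|x-\theta\|^2/2}\,\pi(\|\theta\|^2)\,d\theta$, positive and finite for all $x$ (the constant $2\pi$ in the normal density is the usual number). Define $r(t)=-2t f'(t)/f(t)$ for $t\ge0$; $r^{-1}$ is the inverse function of $r$. For $a>0$ the rescaled marginal is $m_a(x)=f_a(\|x\|^2)$ with $f_a(t)=a^{-d/2}f(t/a)$. Let $\theta_1,\ldots,\theta_k\in\mathbf{R}^d$ be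 different target points and $w_1,\ldots,w_k>0$ fixed weights with $\sum_{i=1}^k w_i=1$. Put $m_{*a}(x)=\sum_{i=1}^k w_i f_a(\|x-\theta_i\|^2)$ and define the multiple shrinkage estimator constructed using $m_a$ as $\delta_{*a}(x)=x+\frac{\nabla m_{*a}(x)}{m_{*a}(x)}$. Let $D=\max_{i\ne j}\|\theta_i-\theta_j\|^2$. *)

(* Defs.v *)
From HB Require Import structures.
From mathcomp Require Import all_boot all_order all_algebra.
From mathcomp Require Import all_classical all_reals all_analysis.

Set Implicit Arguments.
Unset Strict Implicit.
Unset Printing Implicit Defensive.

Import Order.TTheory GRing.Theory Num.Theory.
Import numFieldNormedType.Exports.

Local Open Scope classical_set_scope.
Local Open Scope ring_scope.

Section measurable_rV.
Context {R : realType}.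
Variable n : nat.

Let coors : 'I_n -> 'rV[R]_n -> R := fun i x => x ord0 i.

Let rV_set0 : g_sigma_preimage coors set0.
Proof. exact: sigma_algebra0. Qed.

Let rV_setC A : g_sigma_preimage coors A -> g_sigma_preimage coors (~` A).
Proof. exact: sigma_algebraC. Qed.

Let rV_bigcup (F : _^nat) : (forall i, g_sigma_preimage coors (F i)) ->
  g_sigma_preimage coors (\bigcup_i (F i)).
Proof. exact: sigma_algebra_bigcup. Qed.

(* The sigma-algebra generated by the coordinates, i.e. the Borel one. *)
HB.instance Definition _ := @isMeasurable.Build
  (measure_tuple_display default_measure_display)
  'rV[R]_n (g_sigma_preimage coors) rV_set0 rV_setC rV_bigcup.

Lemma measurable_coord i : measurable_fun [set: 'rV[R]_n] (fun x => x ord0 i).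
Proof.
move=> _ Y mY; rewrite setTI; apply: sub_sigma_algebra => /=.
rewrite -bigcup_seq/=; exists i => /=; first by rewrite mem_index_enum.
by exists Y => //; rewrite setTI.
Qed.

Lemma measurable_fun_rVP d (T : measurableType d) (f : T -> 'rV[R]_n) :
  measurable_fun [set: T] f <->
  forall i, measurable_fun [set: T] (fun x => f x ord0 i).
Proof.
split=> [mf i|mf]; first exact: (measurableT_comp (measurable_coord i)).
have sub : g_sigma_preimage (fun i => coors i \o f) `<=` measurable.
  apply: smallest_sub; first exact: sigma_algebra_measurable.
  rewrite -bigcup_seq; apply: bigcup_sub => i _ A [B mB <-]; exact: mf.
move=> _ A mA; apply: sub; rewrite g_sigma_preimage_comp.
by exists A.
Qed.

End measurable_rV.

Section lebesgue_rV.
Context {R : realType}.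

Definition rV_cons n (p : measurableTypeR R * 'rV[R]_n) : 'rV[R]_n.+1 :=
  row_mx (p.1)%:M p.2 : 'rV[R]_(1 + n).

Lemma rV_cons0 n p : @rV_cons n p ord0 ord0 = p.1.
Proof.
have := row_mxEl (p.1)%:M p.2 ord0 (ord0 : 'I_1); rewrite [in RHS]mxE mulr1n => <-.
by rewrite /rV_cons; congr (_ _ _); exact/val_inj.
Qed.

Lemma rV_consS n p i : @rV_cons n p ord0 (lift ord0 i) = p.2 ord0 i.
Proof.
have <- := row_mxEr (p.1)%:M p.2 ord0 i.
by rewrite /rV_cons; congr (_ _ _); exact/val_inj.
Qed.

Lemma measurable_rV_cons n : measurable_fun setT (@rV_cons n).
Proof.
apply/measurable_fun_rVP => i; have [j ->|->] := unliftP ord0 i.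
  under eq_fun do rewrite rV_consS.
  exact: (measurableT_comp (measurable_coord j) measurable_snd).
by under eq_fun do rewrite rV_cons0; exact: measurable_fst.
Qed.

Fixpoint lebesgue_rV n : set 'rV[R]_n -> \bar R :=
  match n with
  | 0 => @dirac _ 'rV[R]_0 0 R
  | n'.+1 => pushforward (lebesgue_measure \x @lebesgue_rV n')%E (@rV_cons n')
  end.

Arguments lebesgue_rV : clear implicits.

Section rV_step.
Local Open Scope ereal_scope.
Variables (n : nat) (mu : {sigma_finite_measure set 'rV[R]_n -> \bar R}).

Let nu : set 'rV[R]_n.+1 -> \bar R :=
  pushforward (lebesgue_measure \x mu) (@rV_cons n).

Let mcons : measurable_fun setT (@rV_cons n) :=
  @measurable_rV_cons n.

Let nu0 : nu set0 = 0. Proof. exact: measure0. Qed.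

Let nu_ge0 A : 0 <= nu A. Proof. exact: measure_ge0. Qed.

Let nu_sigma_additive : semi_sigma_additive nu.
Proof. exact: measure_semi_sigma_additive. Qed.

HB.instance Definition _ := isMeasure.Build _ _ _ nu
  nu0 nu_ge0 nu_sigma_additive.

Let nu_sigma_finite : sigma_finite setT nu.
Proof.
have /sigma_finiteP[F [TF ndF Foo]] := sigma_finiteT (@lebesgue_measure R).
have /sigma_finiteP[G [TG ndG Goo]] := sigma_finiteT mu.
pose h (x : 'rV[R]_n.+1) : measurableTypeR R * 'rV[R]_n :=
  (x ord0 ord0, \row_j x ord0 (lift ord0 j)).
have hK : h \o @rV_cons n = id.
  apply/funext => -[a x]; rewrite /h /= rV_cons0; congr pair.
  by apply/rowP => j; rewrite mxE rV_consS.
have mh : measurable_fun setT h.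
  apply/measurable_fun_pairP; split; first exact: measurable_coord.
  apply/measurable_fun_rVP => j /=.
  by under eq_fun do rewrite mxE; exact: measurable_coord.
exists (fun k => h @^-1` (F k `*` G k)).
  apply/seteqP; split => // x _.
  have [i _ Fi] : (\bigcup_i F i) (h x).1 by rewrite -TF.
  have [j _ Gj] : (\bigcup_i G i) (h x).2 by rewrite -TG.
  exists (maxn i j) => //; split.
    by move: Fi; exact/subsetPset/ndF/leq_maxl.
  by move: Gj; exact/subsetPset/ndG/leq_maxr.
move=> k; have [mF Fk] := Foo k; have [mG Gk] := Goo k.
have mFG : measurable (F k `*` G k) by exact: measurableX.
split; first by rewrite -[X in measurable X]setTI; exact: mh.
rewrite /nu /pushforward -comp_preimage hK preimage_id.
by rewrite product_measure1E// lte_mul_pinfty// ge0_fin_numE.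
Qed.

HB.instance Definition _ := Measure_isSigmaFinite.Build _ _ _ nu nu_sigma_finite.

Definition rV_step : {sigma_finite_measure set 'rV[R]_n.+1 -> \bar R} := nu.

End rV_step.

Lemma lebesgue_rV_sigma_finite n :
  exists mu : {sigma_finite_measure set 'rV[R]_n -> \bar R},
    lebesgue_rV n = mu.
Proof.
elim: n => [|n [mu muE]]; first by exists (@dirac _ 'rV[R]_0 0 R).
by exists (rV_step mu); rewrite /= muE.
Qed.

Section lebesgue_rV_measure.
Local Open Scope ereal_scope.
Variable n : nat.

Let lebesgue_rV0 : lebesgue_rV n set0 = 0.
Proof. by have [mu ->] := lebesgue_rV_sigma_finite n; exact: measure0. Qed.

Let lebesgue_rV_ge0 A : 0 <= lebesgue_rV n A.
Proof. by have [mu ->] := lebesgue_rV_sigma_finite n; exact: measure_ge0. Qed.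

Let lebesgue_rV_sigma_additive : semi_sigma_additive (lebesgue_rV n).
Proof.
have [mu ->] := lebesgue_rV_sigma_finite n.
exact: measure_semi_sigma_additive.
Qed.

HB.instance Definition _ := isMeasure.Build _ _ _ (lebesgue_rV n)
  lebesgue_rV0 lebesgue_rV_ge0 lebesgue_rV_sigma_additive.

Let sigmaT_finite_lebesgue_rV : sigma_finite setT (lebesgue_rV n).
Proof. by have [mu ->] := lebesgue_rV_sigma_finite n; exact: sigma_finiteT. Qed.

HB.instance Definition _ := Measure_isSigmaFinite.Build _ _ _ (lebesgue_rV n)
  sigmaT_finite_lebesgue_rV.

End lebesgue_rV_measure.

Lemma lebesgue_rV_box n (A : 'I_n -> set (measurableTypeR R)) :
  (forall i, measurable (A i)) ->
  lebesgue_rV n [set x | forall i, A i (x ord0 i)] =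
  (\prod_(i < n) lebesgue_measure (A i))%E.
Proof.
elim: n A => [|n IHn] A mA.
  by rewrite big_ord0 /= diracE mem_set // => -[].
rewrite big_ord_recl -(IHn (fun i => A (lift ord0 i))) //=.
pose B := [set x : 'rV[R]_n | forall i, A (lift ord0 i) (x ord0 i)].
have mB : measurable B.
  rewrite (_ : B = \bigcap_(i in [set: 'I_n])
      (fun x : 'rV[R]_n => x ord0 i) @^-1` A (lift ord0 i)).
    apply: fin_bigcap_measurable => // i _.
    by rewrite -[X in measurable X]setTI; apply: measurable_coord => //; exact: mA.
  by apply/seteqP; split => x /= Ax i; [move=> _|]; exact: Ax.
rewrite -/B -product_measure1E // /pushforward; congr (product_measure1 _ _ _).
apply/seteqP; split => -[y x] /=.
  move=> H; split => /= [|i]; first by have := H ord0; rewrite rV_cons0.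
  by have := H (lift ord0 i); rewrite rV_consS.
by case=> Ay Ax i; have [j ->|->] := unliftP ord0 i;
  [rewrite rV_consS; exact: Ax|rewrite rV_cons0].
Qed.

End lebesgue_rV.
Arguments lebesgue_rV {R} n.

Section shrinkage.
Context {R : realType}.
Variable d : nat.
Local Notation V := 'rV[R]_d.

(* The squared Euclidean norm; the library norm [`|x|] of a row vector is the
   sup norm. *)
Definition sqnorm (x : V) : R := \sum_(i < d) x ord0 i ^+ 2.

Definition normal_rV_pdf (theta x : V) : R :=
  (2 * pi) `^ (- (d%:R / 2)) * expR (- (sqnorm (x - theta) / 2)).

(* Estimators are Borel maps; the risk may be infinite. *)
Definition estimator : set (V -> V) := [set delta | measurable_fun setT delta].

Definition risk (theta : V) (delta : V -> V) : \bar R :=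
  (\int[lebesgue_rV d]_x
     (sqnorm (delta x - theta) * normal_rV_pdf theta x)%:E)%E.

Definition sup_risk (delta : V -> V) : \bar R :=
  ereal_sup [set risk theta delta | theta in [set: V]].

Definition minimax (delta : V -> V) : Prop :=
  estimator delta /\
  sup_risk delta = ereal_inf [set sup_risk delta' | delta' in estimator].

(* Marginal density of the observation under the prior density
   [theta |-> prior (sqnorm theta)], not assumed integrable. *)
Definition marginal (prior : R -> R) (x : V) : \bar R :=
  (\int[lebesgue_rV d]_theta
     (normal_rV_pdf theta x * prior (sqnorm theta))%:E)%E.

Definition grad (g : V -> R) (x : V) : V :=
  \row_(i < d) 'D_(delta_mx ord0 i) g x.

Definition rescaled (a : R) (f : R -> R) (t : R) : R :=
  a `^ (- (d%:R / 2)) * f (t / a).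

Variable k : nat.
Variables (w : 'I_k -> R) (theta : 'I_k -> V) (f : R -> R).

Definition mixture_marginal (a : R) (x : V) : R :=
  \sum_(i < k) w i * rescaled a f (sqnorm (x - theta i)).

Definition multiple_shrinkage (a : R) (x : V) : V :=
  x + (mixture_marginal a x)^-1 *: grad (mixture_marginal a) x.

(* Equal to 0 when there is a single target. *)
Definition max_sqdist : R :=
  \big[Num.max/0]_(p : 'I_k * 'I_k | p.1 != p.2) sqnorm (theta p.1 - theta p.2).

End shrinkage.

(* At t = 0 the factor t makes the value 0, whatever [derive1 f 0] is. *)
Definition shrinkage_factor {R : realType} (f : R -> R) (t : R) : R :=
  - 2 * t * derive1 f t / f t.

(* Inverse of r restricted to [0, +oo[; the default 0 is taken off the image. *)
Definition inverse_nneg {R : realType} (r : R -> R) : R -> R :=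
  'pinv_(fun=> 0) `[0, +oo[ r.

(* Main.v *)
Require Import Defs.
From HB Require Import structures.
From mathcomp Require Import all_boot all_order all_algebra.
From mathcomp Require Import all_classical all_reals all_analysis.
From mathcomp Require Import measurable_realfun.
From mathcomp Require Import ring lra.
Set Implicit Arguments.
Unset Strict Implicit.
Unset Printing Implicit Defensive.
Import Order.TTheory GRing.Theory Num.Theory.
Import numFieldNormedType.Exports.
Local Open Scope classical_set_scope.
Local Open Scope ring_scope.

(* Idea.  Put u_i = x - theta_i, q_i = |u_i|^2, r_i = r(q_i / a), al_i = r_i / q_i
   and v_i = al_i u_i.  The estimator is x + gam(x) with gam = - sum_i p_i v_i, where
   p_i is the posterior weight of the i-th target.  By Stein's identity its risk is
   d + E (2 div gam + |gam|^2), and, since al is nonincreasing and q al(q) is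
   nondecreasing, div v_i >= (d - 2) al_i, so that
     2 div gam + |gam|^2 <= 2 sum_i p_i (r_i - (d - 2)) al_i - |sum_i p_i v_i|^2.
   This is clearly nonpositive when every r_i is at most d - 2.  Otherwise x is so far
   from the targets that |u_i - u_j| <= rho |u_j| for all i, j.  As r_i and al_i are
   oppositely ordered, |v_i - v_j|^2 <= al_i al_j |u_i - u_j|^2; hence
   sum_i p_i |v_i|^2 <= (1 + rho) |sum_i p_i v_i|^2, whereas the bound on rho says
   that 2 (r_i - (d - 2)) (1 + rho) <= r_i.

   Regularity costs little: f(t) exp(t / 2) is nondecreasing, being the Laplace
   transform of a symmetric measure at a point of norm sqrt t, so r(t) <= t and v_i is
   bounded and Lipschitz; the second derivative of f is only used through r'.

   For the lower bound the risk of any estimator is averaged over theta with respect to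
   exp(- eps |theta|^2 / 2) and eps tends to 0.  The normalisation of the Gaussian
   density is never computed: both bounds are d (2 pi)^(- d / 2) times the mass of
   exp(- |y|^2 / 2). *)

(** * Translation invariance on the line and Tonelli for row vectors *)

Section translation.
Context {R : realType}.
Local Open Scope ereal_scope.
Local Notation mu := (@lebesgue_measure R).
(** Lebesgue measure is determined by its values on half-open intervals, and the preimage of such an
    interval under a translation is one of the same length. *)
Lemma lebesgue_measure_shift (c : R) (A : set R) : measurable A ->
  pushforward mu (+%R^~ c : _ -> measurableTypeR R) A = mu A.
Proof.
move=> mA; have mphi : measurable_fun setT (+%R^~ c : measurableTypeR R -> measurableTypeR R).
  by apply: measurable_funD => //; exact: measurable_cst.
have := @lebesgue_measure_unique R (measure_function_pushforward__canonical__measure_function_Measure mu mphi).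
move=> h; apply/esym/h => //= _ [[u v]] _ <-.
rewrite /pushforward (_ : _ @^-1` _ = `](u - c)%R, (v - c)%R]%classic).
  by rewrite !lebesgue_measure_itv/= !lte_fin ltrD2r; case: ltP => // _;
    rewrite -!EFinB; congr EFin; ring.
by apply/seteqP; split => x /=; rewrite !in_itv/=; lra.
Qed.
Lemma ge0_integral_shift1 (c : R) (F : R -> \bar R) :
  measurable_fun [set: R] F -> (forall x, 0 <= F x) ->
  \int[mu]_x F (x + c)%R = \int[mu]_x F x.
Proof.
move=> mF F0.
have mphi : measurable_fun setT (+%R^~ c : measurableTypeR R -> measurableTypeR R).
  by apply: measurable_funD => //; exact: measurable_cst.
have := @ge0_integral_pushforward _ _ _ _ R _ mphi mu setT F measurableT mF (fun x _ => F0 x).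
rewrite preimage_setT => <-.
apply: (@eq_measure_integral _ _ _ setT mu
  (measure_function_pushforward__canonical__measure_function_Measure mu mphi) F).
by move=> A mA _; exact: lebesgue_measure_shift.
Qed.

(** Tonelli's theorem, [lebesgue_rV n.+1] being by construction the image of a product measure under
    [rV_cons]. It drives the inductions on dimension below. *)
Lemma ge0_integral_rV_consE n (F : 'rV[R]_n.+1 -> \bar R) :
  measurable_fun setT F -> (forall x, 0 <= F x) ->
  \int[lebesgue_rV n.+1]_x F x =
  \int[lebesgue_measure]_y \int[lebesgue_rV n]_x F (rV_cons (y, x)).
Proof.
move=> mF F0.
have mFc : measurable_fun setT (F \o @rV_cons R n).
  exact: measurableT_comp mF (@measurable_rV_cons R n).
rewrite (@ge0_integral_pushforward _ _ _ _ R _ (@measurable_rV_cons R n)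
  (lebesgue_measure \x lebesgue_rV n) setT F measurableT mF (fun x _ => F0 x)).
by rewrite preimage_setT (fubini_tonelli1 (F \o @rV_cons R n) mFc (fun x => F0 _)).
Qed.

End translation.

(** * Translation invariance in dimension n and Gaussian integrals *)

Section gaussian_integral.
Context {R : realType}.

Definition gauss_rV n (l : R) (x : 'rV[R]_n) : R := expR (- (l * sqnorm x / 2)).

Lemma sqnorm_ge0 n (x : 'rV[R]_n) : 0 <= sqnorm x.
Proof. by apply: sumr_ge0 => i _; exact: sqr_ge0. Qed.

Lemma sqnorm_cons n (p : measurableTypeR R * 'rV[R]_n) :
  sqnorm (rV_cons p) = p.1 ^+ 2 + sqnorm p.2.
Proof.
rewrite /sqnorm big_ord_recl rV_cons0; congr (_ + _).
by apply: eq_bigr => i _; rewrite rV_consS.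
Qed.

Lemma measurable_sqnorm n : measurable_fun setT (@sqnorm R n).
Proof.
apply: measurable_sum => i; apply: measurable_funX.
exact: measurable_coord.
Qed.

Lemma measurable_addrV n (v : 'rV[R]_n) : measurable_fun setT (fun x : 'rV[R]_n => x + v).
Proof.
apply/measurable_fun_rVP => i; under eq_fun do rewrite mxE.
by apply: measurable_funD => //; exact: measurable_coord.
Qed.

Lemma measurable_gauss_rV n l : measurable_fun setT (@gauss_rV n l).
Proof.
apply: measurableT_comp => //; apply: measurableT_comp => //.
apply: measurable_funM => //; apply: measurable_funM => //.
exact: measurable_sqnorm.
Qed.

Local Open Scope ereal_scope.

(** Induction on the dimension: a shift by [v] moves the first coordinate by a scalar and the
    remaining ones by the tail [v']. *)
Lemma ge0_integral_shift n (v : 'rV[R]_n) (F : 'rV[R]_n -> \bar R) :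
  measurable_fun setT F -> (forall x, 0 <= F x) ->
  \int[lebesgue_rV n]_x F (x + v)%R = \int[lebesgue_rV n]_x F x.
Proof.
elim: n v F => [|n IHn] v F mF F0.
  by apply: eq_integral => x _; congr F; apply/rowP => -[].
have mFc : measurable_fun setT (F \o @rV_cons R n).
  exact: measurableT_comp mF (@measurable_rV_cons R n).
have mFv : measurable_fun setT (fun x : 'rV[R]_n.+1 => F (x + v)%R).
  exact: measurableT_comp mF (measurable_addrV v).
rewrite (ge0_integral_rV_consE mFv (fun x => F0 _)) (ge0_integral_rV_consE mF F0).
pose v' : 'rV[R]_n := \row_j v ord0 (lift ord0 j).
have cE y (x : 'rV[R]_n) :
    (rV_cons (y, x) + v)%R = rV_cons (y + v ord0 ord0, x + v')%R.
  apply/rowP => i; rewrite mxE; have [j ->|->] := unliftP ord0 i.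
    by rewrite !rV_consS/= !mxE.
  by rewrite !rV_cons0.
under eq_integral => y _.
  under eq_integral do rewrite cE.
  rewrite (IHn v' (fun x => F (rV_cons (y + v ord0 ord0, x)%R))
    (measurableT_comp mFc (measurable_pair1 _)) (fun x => F0 _)); over.
apply: (@ge0_integral_shift1 R (v ord0 ord0)
  (fun y => \int[lebesgue_rV n]_x F (rV_cons (y, x)))).
  by apply: (@measurable_fun_fubini_tonelli_F _ _ _ _ R (lebesgue_rV n)
    (F \o @rV_cons R n)) => // x; exact: F0.
by move=> y; exact: integral_ge0.
Qed.

(** The integrand is a multiple of the normal density of standard deviation [s] = l^(-1/2), which
    integrates to 1. *)
Lemma integral_gauss1 (l : R) : (0 < l)%R ->
  exists2 z : R, (0 < z)%R &
  \int[@lebesgue_measure R]_y (expR (- (l * y ^+ 2 / 2)))%:E = z%:E.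
Proof.
move=> l0; pose s : R := Num.sqrt l^-1.
have s0 : s != 0%R by rewrite gt_eqF// sqrtr_gt0 invr_gt0.
exists (normal_peak s)^-1%R; first by rewrite invr_gt0 normal_peak_gt0.
have nE y : expR (- (l * y ^+ 2 / 2)) = ((normal_peak s)^-1 * normal_pdf 0 s y)%R.
  rewrite normal_pdfE//= mulKf ?gt_eqF ?normal_peak_gt0// /normal_fun subr0.
  rewrite /s sqr_sqrtr ?invr_ge0 1?ltW//; congr expR.
  by field; rewrite gt_eqF.
under eq_integral do rewrite nE EFinM.
rewrite integralZl//; last exact: integrable_normal_pdf.
by rewrite integral_normal_pdf mule1.
Qed.

Lemma integral_gauss_rV n (l : R) : (0 < l)%R ->
  exists2 z : R, (0 < z)%R & \int[lebesgue_rV n]_x (gauss_rV l x)%:E = z%:E.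
Proof.
move=> l0; have [z z0 zE] := integral_gauss1 l0.
elim: n => [|n [z' z'0 IHn]].
  exists 1%R => //; rewrite integral_dirac//; last first.
    by apply/measurable_EFinP; exact: measurable_gauss_rV.
  by rewrite diracT mul1e /gauss_rV /sqnorm big_ord0 mulr0 mul0r oppr0 expR0.
exists (z * z')%R; first exact: mulr_gt0.
have mG k : measurable_fun setT (fun x : 'rV[R]_k => (gauss_rV l x)%:E).
  by apply/measurable_EFinP; exact: measurable_gauss_rV.
have G0 k (x : 'rV[R]_k) : 0 <= (gauss_rV l x)%:E by rewrite lee_fin expR_ge0.
have mE : measurable_fun [set: measurableTypeR R] (fun y : R => (expR (- (l * y ^+ 2 / 2)))%:E).
  apply/measurable_EFinP; apply: measurableT_comp => //.
  apply: measurableT_comp => //; apply: measurable_funM => //.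
  by apply: measurable_funM => //; exact: measurable_funX.
have E0 (y : R) : 0 <= (expR (- (l * y ^+ 2 / 2)))%:E by rewrite lee_fin expR_ge0.
rewrite (ge0_integral_rV_consE (mG _) (@G0 _)).
have inner (y : R) : \int[lebesgue_rV n]_x (gauss_rV l (rV_cons (y, x)))%:E =
    (expR (- (l * y ^+ 2 / 2)))%:E * z'%:E.
  rewrite -IHn -(ge0_integralZl _ measurableT (mG n) (fun x _ => G0 _ x) (E0 y)).
  apply: eq_integral => x _.
  by rewrite /gauss_rV sqnorm_cons -EFinM -expRD; congr (expR _)%:E => /=; field.
under eq_integral do rewrite inner.
rewrite (ge0_integralZr _ measurableT mE (fun y _ => E0 y)); first by rewrite zE.
by rewrite lee_fin ltW.
Qed.

Lemma integrable_gauss_rV n (l : R) : (0 < l)%R ->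
  (lebesgue_rV n).-integrable setT (EFin \o gauss_rV l).
Proof.
move=> l0; apply/integrableP; split.
  by apply/measurable_EFinP; exact: measurable_gauss_rV.
have [z _ zE] := integral_gauss_rV n l0.
under eq_integral do rewrite /= ger0_norm ?expR_ge0//.
by rewrite zE ltry.
Qed.

End gaussian_integral.

(** * Stein's identity for Gaussian weights *)

Section stein_identity.
Context {R : realType}.
Variable n : nat.
Local Notation V := 'rV[R]_n.
Local Notation mu := (lebesgue_rV n).

Lemma integrable_dominated (f G : V -> R) : measurable_fun setT f ->
  (forall x, `|f x| <= G x) -> mu.-integrable setT (EFin \o G) ->
  mu.-integrable setT (EFin \o f).
Proof.
move=> mf fG; apply: le_integrable => //; first exact/measurable_EFinP.
by move=> x _; rewrite /= lee_fin (le_trans (fG x)) ?ler_norm.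
Qed.

(** Positive and negative parts are translated separately, so integrability is not asked of [F]. *)
Lemma integral_shift (v : V) (F : V -> \bar R) : measurable_fun setT F ->
  (\int[mu]_x F (x + v)%R = \int[mu]_x F x)%E.
Proof.
move=> mF; rewrite integralE [RHS]integralE.
rewrite -[X in _ = (X - _)%E](ge0_integral_shift v) //; last exact: measurable_funepos.
rewrite -[X in _ = (_ - X)%E](ge0_integral_shift v) //; last exact: measurable_funeneg.
have shE : (fun x => F (x + v)) = F \o (+%R^~ v) by [].
by rewrite shE funepos_comp funeneg_comp.
Qed.

Lemma measurable_addVr (v : V) : measurable_fun setT (fun x : V => v + x).
Proof. by under eq_fun do rewrite addrC; exact: measurable_addrV. Qed.

Lemma sqnormD_delta j (t : R) (y : V) :
  sqnorm (y + t *: delta_mx ord0 j) = sqnorm y + 2 * t * y ord0 j + t ^+ 2.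
Proof.
rewrite /sqnorm (bigD1 j)//= [in RHS](bigD1 j)//= !mxE !eqxx mulr1.
rewrite (eq_bigr (fun i => y ord0 i ^+ 2)) => [|i /negPf ij].
  by rewrite sqrrD -mulr_natl; ring.
by rewrite !mxE eqxx ij mulr0 addr0.
Qed.

(** Exponential tilting. It serves both to integrate exponentials against the Gaussian and to
    differentiate in the shift [t]. *)
Lemma gauss_rV_shift (l t : R) j (y : V) : gauss_rV l (y - t *: delta_mx ord0 j) =
  expR (l * (t * y ord0 j - t ^+ 2 / 2)) * gauss_rV l y.
Proof.
rewrite -scaleNr /gauss_rV sqnormD_delta -expRD; congr expR; by field.
Qed.

(** By tilting, an exponential in y_j times the Gaussian is a multiple of a translated Gaussian;
    exp(c |y_j|) is dominated by the sum of the exponentials of c y_j and - c y_j. *)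
Lemma integrable_gauss_rV_expR (l c : R) j : 0 < l ->
  mu.-integrable setT (EFin \o (fun y : V => expR (c * `|y ord0 j|) * gauss_rV l y)).
Proof.
move=> l0.
have cexp c' : mu.-integrable setT
    (EFin \o (fun y : V => expR (c' * y ord0 j) * gauss_rV l y)).
  have /(integrableZl measurableT (expR (c' ^+ 2 / (2 * l)))) :
      mu.-integrable setT
        (EFin \o (fun y : V => gauss_rV l (y - (c' / l) *: delta_mx ord0 j))).
    apply/integrableP; split.
      apply/measurable_EFinP; apply: measurableT_comp (measurable_addrV _).
      exact: measurable_gauss_rV.
    have /integrableP[mg] := integrable_gauss_rV n l0.
    rewrite -(integral_shift (- ((c' / l) *: delta_mx ord0 j)))//.
    exact: measurableT_comp.
  apply: eq_integrable => // y _ /=.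
  rewrite gauss_rV_shift -EFinM mulrA -expRD; congr (expR _ * _)%:E.
  by field; rewrite gt_eqF.
have /= := integrableD measurableT (cexp c) (cexp (- c)).
apply: integrable_dominated => [|y].
  apply: measurable_funM; last exact: measurable_gauss_rV.
  apply: measurableT_comp => //; apply: measurable_funM => //.
  by apply: measurableT_comp => //; exact: measurable_coord.
rewrite ger0_norm ?mulr_ge0 ?expR_ge0//= -mulrDl ler_wpM2r ?expR_ge0//.
case: (ger0P (y ord0 j)) => _; first by rewrite lerDl expR_ge0.
by rewrite mulrN -mulNr lerDr expR_ge0.
Qed.

Lemma ler_expR_id (x : R) : x <= expR x.
Proof. by rewrite (le_trans _ (expR_ge1Dx x))// lerDr. Qed.

Lemma is_derive_line (g : V -> R) (y e : V) (s D : R) :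
  is_derive (s *: e + y) e g D -> is_derive s 1 (fun t => g (t *: e + y)) D.
Proof.
move=> [dg <-].
have E : (fun h : R => h^-1 *: (g ((h *: 1 + s) *: e + y) - g (s *: e + y))) =
         (fun h : R => h^-1 *: (g (h *: e + (s *: e + y)) - g (s *: e + y))).
  by apply/funext => h; rewrite addrA -scalerDl [h *: 1]mulr1.
by split; rewrite /derivable /derive /= E.
Qed.

(** Rather than integrating by parts, one differentiates the integral of gauss(y) g(y + s e) at s =
    0 in two ways: directly on [g], and, after a translation, on the Gaussian. *)
Lemma stein_identity (l A L : R) j (g g' : V -> R) : 0 < l ->
  measurable_fun setT g -> (forall y, `|g y| <= A * expR `|y ord0 j|) ->
  (forall y, is_derive y (delta_mx ord0 j) g (g' y)) -> (forall y, `|g' y| <= L) ->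
  [/\ mu.-integrable setT (EFin \o (fun y => gauss_rV l y * g' y)),
      mu.-integrable setT (EFin \o (fun y => gauss_rV l y * (y ord0 j * g y))) &
      \int[mu]_y (gauss_rV l y * g' y) =
        l * \int[mu]_y (gauss_rV l y * (y ord0 j * g y))].
Proof.
move=> l0 mg gA dg g'L; set e : V := delta_mx ord0 j.
have A0 : 0 <= A.
  have := gA 0; rewrite mxE normr0 expR0 mulr1; exact: le_trans.
have L0 : 0 <= L by apply: le_trans (g'L 0).
have dgs s y : is_derive s (1 : R) (fun t => g (t *: e + y)) (g' (s *: e + y)).
  exact: is_derive_line.
have mgauss : measurable_fun setT (@gauss_rV R n l) by exact: measurable_gauss_rV.
(* [g'] is a pointwise limit of difference quotients with steps [harmonic m]. *)
have mg' : measurable_fun setT g'.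
  apply: (@measurable_fun_cvg _ _ _ _ (fun m y =>
    (harmonic m)^-1 * (g (harmonic m *: e + y) - g y))) => [m|y _].
    apply: measurable_funM => //; apply: measurable_funB => //.
    apply: (measurableT_comp mg).
    exact: measurable_addVr.
  have [dgy <-] := dg y.
  have /cvgr_dnbhsP := dgy.
  apply => //; split; last exact: cvg_harmonic.
  by move=> m; rewrite /harmonic gt_eqF// invr_gt0 ltr0n.
pose J := `]-1, (1:R)[%classic.
(* [f1] carries the shift [s] on the Gaussian and [f2] carries it on [g]; their integrals agree for
   every [s]. *)
pose f1 (s : R) (y : V) := expR (l * (s * y ord0 j - s ^+ 2 / 2)) * (gauss_rV l y * g y).
pose f2 (s : R) (y : V) := gauss_rV l y * g (s *: e + y).
have J0 : J 0 by rewrite /J /= in_itv/=; lra.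
have JP s : J s -> `|s| <= 1 by rewrite /J /= in_itv/= ler_norml => /andP[]; lra.
have f12 : (fun s => \int[mu]_y f1 s y) = (fun s => \int[mu]_y f2 s y).
  apply/funext => s; rewrite /Rintegral; congr fine.
  rewrite -(integral_shift (s *: e)).
    apply: eq_integral => y _; rewrite /f1 mulrA -gauss_rV_shift addrK.
    by rewrite /f2 addrC.
  apply/measurable_EFinP; apply: measurable_funM; last exact: measurable_funM.
  apply: measurableT_comp => //; apply: measurable_funM => //.
  by apply: measurable_funB => //; apply: measurable_funM => //; exact: measurable_coord.
have mf1 s : measurable_fun setT (f1 s).
  apply: measurable_funM; last exact: measurable_funM.
  apply: measurableT_comp => //; apply: measurable_funM => //.
  by apply: measurable_funB => //; apply: measurable_funM => //; exact: measurable_coord.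
have mf2 s : measurable_fun setT (f2 s).
  apply: measurable_funM => //; apply: (measurableT_comp mg).
  exact: measurable_addVr.
have f1_le s y : J s -> `|f1 s y| <= A * (expR ((l + 1) * `|y ord0 j|) * gauss_rV l y).
  move=> /JP s1; rewrite /f1 !normrM [`|expR _|]ger0_norm ?expR_ge0//.
  rewrite [`|gauss_rV _ _|]ger0_norm ?expR_ge0// mulrDl mul1r expRD.
  have -> : A * (expR (l * `|y ord0 j|) * expR `|y ord0 j| * gauss_rV l y) =
    expR (l * `|y ord0 j|) * (gauss_rV l y * (A * expR `|y ord0 j|)) by ring.
  apply: ler_pM => //; rewrite ?expR_ge0 ?mulr_ge0 ?expR_ge0//.
    rewrite ler_expR ler_pM2l//.
    apply: (@le_trans _ _ (s * y ord0 j)); first by rewrite gerBl divr_ge0 ?sqr_ge0.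
    by rewrite (le_trans (ler_norm _))// normrM ler_piMl.
  by rewrite ler_wpM2l ?expR_ge0.
have intE c C : mu.-integrable setT
    (EFin \o (fun y : V => C * (expR (c * `|y ord0 j|) * gauss_rV l y))).
  have := integrableZl measurableT C (integrable_gauss_rV_expR c j l0).
  exact: eq_integrable.
have intf1 s : J s -> mu.-integrable setT (EFin \o f1 s).
  move=> Js; apply: (integrable_dominated (mf1 s)) (intE (l + 1) A) => y.
  exact: f1_le.
have intf2 s : J s -> mu.-integrable setT (EFin \o f2 s).
  move=> /JP s1; apply: (integrable_dominated (mf2 s)) (intE 1 (A * expR 1)) => y.
  rewrite /f2 normrM ger0_norm ?expR_ge0// [leRHS](_ : _ =
    gauss_rV l y * (A * (expR 1 * expR (1 * `|y ord0 j|)))); last by ring.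
  rewrite ler_wpM2l ?expR_ge0// (le_trans (gA _))// ler_wpM2l//.
  rewrite -expRD ler_expR !mxE !eqxx mulr1 mul1r (le_trans (ler_normD _ _))//.
  by rewrite lerD2r.
have df1 s y : is_derive s (1 : R) (f1 ^~ y) (l * (y ord0 j - s) * f1 s y).
  rewrite /f1; set C := gauss_rV l y * g y; set yj := y ord0 j.
  apply: is_derive_eq.
  by rewrite /GRing.scale/=; field.
have df2 s y : is_derive s (1 : R) (f2 ^~ y) (gauss_rV l y * g' (s *: e + y)).
  exact: (is_deriveZ (gauss_rV l y) (dgs s y)).
have d1E s y : partial1of2 f1 s y = l * (y ord0 j - s) * f1 s y.
  by rewrite partial1of2E; have [_ ->] := df1 s y.
have d2E s y : partial1of2 f2 s y = gauss_rV l y * g' (s *: e + y).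
  by rewrite partial1of2E; have [_ ->] := df2 s y.
have D1 s y : J s -> setT y -> derivable (f1 ^~ y) s 1 by have [] := df1 s y.
have D2 s y : J s -> setT y -> derivable (f2 ^~ y) s 1 by have [] := df2 s y.
(* The exponent [l + 2] is [l + 1] from [f1_le] plus one unit that absorbs |y_j - s| <= 1 + |y_j| <=
   exp |y_j|. *)
have G1 s y : J s -> setT y -> `|partial1of2 f1 s y| <=
    (l * A) * (expR ((l + 2) * `|y ord0 j|) * gauss_rV l y).
  move=> Js _; have s1 := JP _ Js; rewrite d1E normrM.
  rewrite [leRHS](_ : _ = (l * expR `|y ord0 j|) *
     (A * (expR ((l + 1) * `|y ord0 j|) * gauss_rV l y))); last first.
    have -> : l + 2 = 1 + (l + 1) by ring.
    by rewrite [in LHS]mulrDl mul1r expRD; ring.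
  apply: ler_pM => //; last exact: f1_le.
  rewrite normrM ger0_norm ?(ltW l0)// ler_pM2l// (le_trans _ (expR_ge1Dx _))//.
  by rewrite (le_trans (ler_normB _ _))// addrC lerD2r.
have G2 s y : J s -> setT y -> `|partial1of2 f2 s y| <=
    L * (expR (0 * `|y ord0 j|) * gauss_rV l y).
  move=> _ _; rewrite d2E normrM ger0_norm ?expR_ge0//.
  by rewrite mul0r expR0 mul1r mulrC ler_wpM2r ?expR_ge0.
have E1 := @differentiation_under_integral R _ _ mu f1 setT measurableT 0 (-1) 1 J0
  intf1 D1 (fun y : V => (l * A) * (expR ((l + 2) * `|y ord0 j|) * gauss_rV l y))
  _ (intE _ _) G1.
have E2 := @differentiation_under_integral R _ _ mu f2 setT measurableT 0 (-1) 1 J0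
  intf2 D2 (fun y : V => L * (expR (0 * `|y ord0 j|) * gauss_rV l y))
  _ (intE _ _) G2.
have d10E y : partial1of2 f1 0 y = l * (gauss_rV l y * (y ord0 j * g y)).
  rewrite d1E /f1 subr0 mul0r expr0n/= mul0r subr0 mulr0 expR0 mul1r; ring.
have intyg : mu.-integrable setT (EFin \o (fun y => gauss_rV l y * (y ord0 j * g y))).
  apply: (integrable_dominated _ _ (intE (l + 2) A)) => [|y].
    apply: measurable_funM; first exact: mgauss.
    by apply: measurable_funM; [exact: measurable_coord|exact: mg].
  have := G1 0 y J0 I; rewrite d10E normrM ger0_norm ?(ltW l0)// -mulrA.
  by rewrite ler_pM2l.
split; [|exact: intyg|].
  apply: (integrable_dominated _ _ (intE 0 L)); first exact: measurable_funM.
  by move=> y; have := G2 0 y J0 I; rewrite d2E scale0r add0r.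
have -> : \int[mu]_y (gauss_rV l y * g' y) = \int[mu]_y partial1of2 f2 0 y.
  by apply: eq_Rintegral => y _; rewrite d2E scale0r add0r.
have E12 : \int[mu]_y partial1of2 f2 0 y = \int[mu]_y partial1of2 f1 0 y.
  rewrite -E2 -?E1; first by congr (derive1 _ 0); exact/esym.
  - by move=> y; rewrite !mulr_ge0 ?expR_ge0// ltW.
  - by move=> y; rewrite !mulr_ge0 ?expR_ge0.
by rewrite E12 -(RintegralZl l measurableT intyg); apply: eq_Rintegral => y _;
  rewrite d10E.
Qed.

End stein_identity.

(** * First and second Gaussian moments *)

Section gaussian_moments.
Context {R : realType}.
Variable n : nat.
Local Notation V := 'rV[R]_n.
Local Notation mu := (lebesgue_rV n).

Definition gauss_mass (l : R) : R := \int[mu]_y gauss_rV l y.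

Lemma gauss_mass_gt0 (l : R) : 0 < l -> 0 < gauss_mass l.
Proof. by move=> l0; have [z z0 zE] := integral_gauss_rV n l0; rewrite /gauss_mass /Rintegral zE. Qed.

Lemma integral_gauss_massE (l : R) : 0 < l ->
  (\int[mu]_y (gauss_rV l y)%:E = (gauss_mass l)%:E)%E.
Proof. by move=> l0; have [z z0 zE] := integral_gauss_rV n l0; rewrite /gauss_mass /Rintegral zE. Qed.

Lemma EFin_Rintegral (f : V -> R) : mu.-integrable setT (EFin \o f) ->
  (\int[mu]_y (f y)%:E = (\int[mu]_y f y)%:E)%E.
Proof. by move=> intf; rewrite /Rintegral fineK//; exact: integrable_fin_num. Qed.

Lemma is_derive_coord (y : V) j : is_derive y (delta_mx ord0 j) (fun x : V => x ord0 j) 1.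
Proof.
have E : (fun h : R => h^-1 *: (((h *: delta_mx ord0 j + y) : V) ord0 j - y ord0 j))
    @ 0^' --> (1 : R).
  apply: cvg_near_cst; near=> h; apply/eqP.
  rewrite !mxE !eqxx mulr1 addrK /GRing.scale/= mulVf//.
  by near: h; exact: nbhs_dnbhs_neq.
split; first exact: (cvgP _ E).
exact: (cvg_lim _ E).
Unshelve. all: by end_near. Qed.

(** Stein's identity for the constant 1 gives mean zero, and for y_j - c the second moment. The
    square is split as y_j (y_j - c) - c y_j + c^2. *)
Lemma gauss_affine_sqr (l c : R) j : 0 < l ->
  mu.-integrable setT (EFin \o (fun y : V => gauss_rV l y * (y ord0 j - c) ^+ 2)) /\
  \int[mu]_y (gauss_rV l y * (y ord0 j - c) ^+ 2) =
    gauss_mass l / l + c ^+ 2 * gauss_mass l.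
Proof.
move=> l0.
have intG := integrable_gauss_rV n l0.
have coordA (c' : R) (y : V) : `|y ord0 j - c'| <= (1 + `|c'|) * expR `|y ord0 j|.
  rewrite (le_trans (ler_normB _ _))// mulrDl mul1r lerD ?ler_expR_id//.
  by rewrite ler_peMr// -expR0 ler_expR.
have mcoord (c' : R) : measurable_fun setT (fun y : V => y ord0 j - c').
  by apply: measurable_funB => //; exact: measurable_coord.
have dcoord (c' : R) (y : V) :
    is_derive y (delta_mx ord0 j) (fun y : V => y ord0 j - c') 1.
  have := is_deriveB (is_derive_coord y j) (is_derive_cst c' y (delta_mx ord0 j)).
  by rewrite subr0.
have c1 (y : V) : `|1 : R| <= 1 by rewrite normr1.
have k1 (y : V) : `|1 : R| <= 1 * expR `|y ord0 j|.
  by rewrite normr1 mul1r -expR0 ler_expR.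
have k0 (y : V) : `|0 : R| <= 0 by rewrite normr0.
have [_ i0 e0] := stein_identity l0 (measurable_cst (1 : R)) k1
  (fun y => is_derive_cst (1 : R) y (delta_mx ord0 j)) k0.
have [_ i1 e1] := stein_identity l0 (mcoord c) (coordA c) (dcoord c) c1.
have {}e0 : \int[mu]_y (gauss_rV l y * (y ord0 j * 1)) = 0.
  apply: (mulfI (lt0r_neq0 l0)); rewrite -e0 mulr0.
  by under eq_Rintegral do rewrite mulr0; rewrite Rintegral_cst// mul0r.
have {}e1 : \int[mu]_y (gauss_rV l y * (y ord0 j * (y ord0 j - c))) = gauss_mass l / l.
  apply: (mulfI (lt0r_neq0 l0)); rewrite -e1 mulrC divfK ?gt_eqF//.
  by apply: eq_Rintegral => y _; rewrite mulr1.
have i0c : mu.-integrable setT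
    (EFin \o (fun y : V => - c * (gauss_rV l y * (y ord0 j * 1)))).
  exact: (integrableZl measurableT (- c) i0).
have iGc : mu.-integrable setT (EFin \o (fun y : V => c ^+ 2 * gauss_rV l y)).
  exact: (integrableZl measurableT (c ^+ 2) intG).
have i01 : mu.-integrable setT
    (EFin \o (fun y : V => - c * (gauss_rV l y * (y ord0 j * 1)) + c ^+ 2 * gauss_rV l y)).
  exact: (integrableD measurableT i0c iGc).
have fE (y : V) : gauss_rV l y * (y ord0 j - c) ^+ 2 =
    gauss_rV l y * (y ord0 j * (y ord0 j - c)) +
    (- c * (gauss_rV l y * (y ord0 j * 1)) + c ^+ 2 * gauss_rV l y) by ring.
split.
  apply: eq_integrable (integrableD measurableT i1 i01) => // y _ /=.
  by rewrite fE.
rewrite (eq_Rintegral _ (fun y _ => fE y)).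
rewrite (RintegralD measurableT i1 i01) (RintegralD measurableT i0c iGc).
by rewrite (RintegralZl _ measurableT i0) (RintegralZl _ measurableT intG) e0 e1 mulr0 add0r.
Qed.

End gaussian_moments.

(** * Bayes risk under an unnormalised Gaussian prior *)

Section lower_bound.
Context {R : realType}.
Variable n : nat.
Local Notation V := 'rV[R]_n.
Local Notation mu := (lebesgue_rV n).

Lemma Rintegral_sum (I : Type) (s : seq I) (f : I -> V -> R) :
  (forall i, mu.-integrable setT (EFin \o f i)) ->
  mu.-integrable setT (EFin \o (fun y => \sum_(i <- s) f i y)) /\
  \int[mu]_y (\sum_(i <- s) f i y) = \sum_(i <- s) \int[mu]_y f i y.
Proof.
move=> intf; elim: s => [|i s [ints IHs]].
  rewrite big_nil; split; last first.
    by under eq_Rintegral do rewrite big_nil; rewrite Rintegral_cst// mul0r.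
  apply: eq_integrable (integrable0 mu setT) => // y _ /=.
  by rewrite big_nil.
split.
  apply: eq_integrable (integrableD measurableT (intf i) ints) => // y _ /=.
  by rewrite big_cons.
under eq_Rintegral do rewrite big_cons.
by rewrite big_cons (RintegralD measurableT (intf i) ints) IHs.
Qed.

(** After recentring at [m], each coordinate contributes a variance term and a nonnegative squared
    bias, which is dropped. *)
Lemma gauss_sqnorm_ge (l : R) (e m : V) : 0 < l ->
  ((n%:R * (gauss_mass n l / l))%:E <=
   \int[mu]_y (sqnorm (e - y) * gauss_rV l (y - m))%:E)%E.
Proof.
move=> l0; pose f j (y : V) := gauss_rV l y * (y ord0 j - (e - m) ord0 j) ^+ 2.
have [intf Ef] := Rintegral_sum (index_enum 'I_n) (fun j => (gauss_affine_sqr ((e - m) ord0 j) j l0).1).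
rewrite [leRHS](_ : _ = (\int[mu]_y (\sum_j f j y)%:E)%E); last first.
  rewrite -(integral_shift m); last first.
    apply/measurable_EFinP; apply: measurable_funM.
      apply: measurableT_comp; first exact: measurable_sqnorm.
      apply/measurable_fun_rVP => i; under eq_fun do rewrite !mxE.
      by apply: measurable_funB => //; exact: measurable_coord.
    exact: (measurableT_comp (@measurable_gauss_rV R n l) (measurable_addrV (- m))).
  apply: eq_integral => y _; congr EFin; rewrite addrK /sqnorm mulr_suml.
  by apply: eq_bigr => j _; rewrite /f !mxE mulrC; congr (_ * _); ring.
rewrite (EFin_Rintegral intf) Ef lee_fin mulr_natl -[n in _ *+ n]card_ord -sumr_const.
apply: ler_sum => j _; rewrite (gauss_affine_sqr ((e - m) ord0 j) j l0).2 lerDl.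
by rewrite mulr_ge0 ?sqr_ge0 ?ltW ?gauss_mass_gt0.
Qed.

(** Bayes' formula: given [x], the parameter is Gaussian of precision [1 + eps] about x / (1 +
    eps). *)
Lemma gauss_rV_complete_square (eps : R) (x t : V) : 0 < eps ->
  gauss_rV 1 (x - t) * gauss_rV eps t =
  gauss_rV (eps / (1 + eps)) x * gauss_rV (1 + eps) (t - (1 + eps)^-1 *: x).
Proof.
move=> e0; rewrite /gauss_rV -!expRD; congr expR.
rewrite -!mulNr -!mulrDl; congr (_ / _).
rewrite /sqnorm !mulr_sumr -!big_split/=; apply: eq_bigr => i _.
by rewrite !mxE; field; lra.
Qed.

(** Once the order of integration is exchanged, the inner integral at fixed [x] is a posterior mean
    squared error, hence at least the posterior variance n / (1 + eps) times the posterior mass. The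
    measurability is what allows a bound on each risk to be integrated over [t]. *)
Lemma gauss_bayes_le (delta : V -> V) (eps : R) : measurable_fun setT delta -> 0 < eps ->
  measurable_fun setT (fun t : V => \int[mu]_x
     (sqnorm (delta x - t) * gauss_rV 1 (x - t) * gauss_rV eps t)%:E)%E /\
  ((n%:R / (1 + eps) * (gauss_mass n 1 * gauss_mass n eps))%:E <=
   \int[mu]_t \int[mu]_x
     (sqnorm (delta x - t) * gauss_rV 1 (x - t) * gauss_rV eps t)%:E)%E.
Proof.
move=> mdelta e0; have e1 : 0 < 1 + eps by lra.
have msub (T : measurableType _) (f g : T -> V) : measurable_fun setT f ->
    measurable_fun setT g -> measurable_fun setT (fun x => f x - g x).
  move=> /measurable_fun_rVP mf /measurable_fun_rVP mg.
  apply/measurable_fun_rVP => i; under eq_fun do rewrite !mxE.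
  exact: measurable_funB.
have mW : measurable_fun setT (fun p : V * V => (gauss_rV 1 (p.2 - p.1) * gauss_rV eps p.1)).
  apply: measurable_funM; first apply: measurableT_comp.
  - exact: measurable_gauss_rV.
  - apply: msub; [exact: measurable_snd|exact: measurable_fst].
  - by apply: measurableT_comp measurable_fst; exact: measurable_gauss_rV.
have mF : measurable_fun setT (fun p : V * V =>
    (sqnorm (delta p.2 - p.1) * gauss_rV 1 (p.2 - p.1) * gauss_rV eps p.1)%:E).
  under eq_fun do rewrite -mulrA.
  apply/measurable_EFinP; apply: measurable_funM mW.
  apply: measurableT_comp; first exact: measurable_sqnorm.
  apply: msub; last exact: measurable_fst.
  exact: measurableT_comp mdelta measurable_snd.
have {}mW : measurable_fun setT (fun p : V * V =>
    (gauss_rV 1 (p.2 - p.1) * gauss_rV eps p.1)%:E) by apply/measurable_EFinP.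
have G0 l (x : V) : 0 <= gauss_rV l x by exact: expR_ge0.
have F0 (p : V * V) :
    (0 <= (sqnorm (delta p.2 - p.1) * gauss_rV 1 (p.2 - p.1) * gauss_rV eps p.1)%:E)%E.
  by rewrite lee_fin !mulr_ge0 ?sqnorm_ge0.
have W0 (p : V * V) : (0 <= (gauss_rV 1 (p.2 - p.1) * gauss_rV eps p.1)%:E)%E.
  by rewrite lee_fin mulr_ge0.
split; first exact: (@measurable_fun_fubini_tonelli_F _ _ _ _ R mu _ mF F0).
rewrite (@fubini_tonelli _ _ _ _ R mu mu (fun p : V * V =>
    (sqnorm (delta p.2 - p.1) * gauss_rV 1 (p.2 - p.1) * gauss_rV eps p.1)%:E) mF F0)/=.
have mG l : measurable_fun setT (fun y : V => (gauss_rV l y)%:E).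
  by apply/measurable_EFinP; exact: measurable_gauss_rV.
have gE0 l (y : V) : (0 <= (gauss_rV l y)%:E)%E by rewrite lee_fin.
have massE : ((gauss_mass n 1 * gauss_mass n eps)%:E =
    \int[mu]_t \int[mu]_x (gauss_rV 1 (x - t) * gauss_rV eps t)%:E)%E.
  rewrite EFinM -(integral_gauss_massE n e0).
  rewrite -(ge0_integralZl _ measurableT (mG _) (fun x _ => gE0 _ x)); last first.
    by rewrite lee_fin ltW// gauss_mass_gt0.
  apply: eq_integral => t _.
  under [RHS]eq_integral do rewrite EFinM.
  have mGt : measurable_fun setT (fun x : V => (gauss_rV 1 (x - t))%:E).
    exact: (measurableT_comp (mG 1) (measurable_addrV (- t))).
  rewrite (ge0_integralZr _ measurableT mGt (fun _ _ => gE0 _ _) (gE0 _ _)).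
  by rewrite -(integral_gauss_massE n ltr01) -(ge0_integral_shift (- t) (mG 1) (gE0 1)).
(* The product of masses, read as a double integral, is exchanged as well, so that the two sides can
   be compared for each [x]. *)
rewrite EFinM massE.
rewrite (@fubini_tonelli _ _ _ _ R mu mu (fun p : V * V =>
    (gauss_rV 1 (p.2 - p.1) * gauss_rV eps p.1)%:E) mW W0)/=.
have mWG := @measurable_fun_fubini_tonelli_G _ _ _ _ R mu _ mW W0.
have WG0 (x : V) : (0 <= \int[mu]_t (gauss_rV 1 (x - t) * gauss_rV eps t)%:E)%E.
  by apply: integral_ge0 => t _; exact: (W0 (t, x)).
have ne0 : (0 <= (n%:R / (1 + eps))%:E)%E by rewrite lee_fin divr_ge0 ?ler0n ?ltW.
rewrite -(ge0_integralZl _ measurableT mWG (fun x _ => WG0 x) ne0).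
apply: ge0_le_integral.
- exact: measurableT.
- by move=> x _; exact: mule_ge0 ne0 (WG0 x).
- by apply: measurable_funeM; exact: mWG.
- exact: (@measurable_fun_fubini_tonelli_G _ _ _ _ R mu _ mF F0).
move=> x _.
set c := gauss_rV (eps / (1 + eps)) x; set m := (1 + eps)^-1 *: x.
have c0 : 0 <= c by exact: G0.
have mGm : measurable_fun setT (fun t : V => (gauss_rV (1 + eps) (t - m))%:E).
  exact: (measurableT_comp (mG (1 + eps)) (measurable_addrV (- m))).
have WE : (\int[mu]_t (gauss_rV 1 (x - t) * gauss_rV eps t)%:E =
    (c * gauss_mass n (1 + eps))%:E)%E.
  under eq_integral do rewrite gauss_rV_complete_square// EFinM.
  rewrite (ge0_integralZl _ measurableT mGm (fun _ _ => gE0 _ _)) ?lee_fin//.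
  by rewrite (ge0_integral_shift (- m) (mG (1 + eps)) (gE0 _)) integral_gauss_massE// EFinM.
rewrite /fubini_G/= WE -EFinM.
have mS : measurable_fun setT (fun t : V => (sqnorm (delta x - t) * gauss_rV (1 + eps) (t - m))%:E).
  apply/measurable_EFinP; apply: measurable_funM.
    by apply: measurableT_comp; [exact: measurable_sqnorm|apply: msub].
  exact: (measurableT_comp (@measurable_gauss_rV R n (1 + eps)) (measurable_addrV (- m))).
have FE t : (sqnorm (delta x - t) * gauss_rV 1 (x - t) * gauss_rV eps t)%:E =
    (c%:E * (sqnorm (delta x - t) * gauss_rV (1 + eps) (t - m))%:E)%E.
  by rewrite -mulrA gauss_rV_complete_square// -EFinM; congr EFin; rewrite mulrCA.
under eq_integral do rewrite FE.
rewrite (ge0_integralZl _ measurableT mS); last 2 first.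
- by move=> t _; rewrite lee_fin mulr_ge0 ?sqnorm_ge0.
- by rewrite lee_fin.
rewrite [X in (X%:E <= _)%E](_ : _ = c * (n%:R * (gauss_mass n (1 + eps) / (1 + eps)))); last first.
  by field; rewrite gt_eqF.
rewrite EFinM lee_wpmul2l ?lee_fin//.
exact: gauss_sqnorm_ge.
Qed.

End lower_bound.

(** * Lower bound for the supremum risk of every estimator *)

Section risk_lower_bound.
Context {R : realType}.
Variable n : nat.
Local Notation V := 'rV[R]_n.
Local Notation mu := (lebesgue_rV n).
Local Notation kappa := ((2 * pi) `^ (- (n%:R / 2)) : R).

Lemma kappa_gt0 : 0 < kappa.
Proof. by rewrite powR_gt0// mulr_gt0// pi_gt0. Qed.

Lemma normal_rV_pdfE (t x : V) : normal_rV_pdf t x = kappa * gauss_rV 1 (x - t).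
Proof. by rewrite /normal_rV_pdf /gauss_rV mul1r. Qed.

(** The risk averaged over [gauss_rV eps] is at most the supremum times the mass of that weight. The
    mass cancels against the one in [gauss_bayes_le], and [eps] tends to 0. *)
Lemma sup_risk_ge (delta : V -> V) : measurable_fun setT delta ->
  ((kappa * (n%:R * gauss_mass n 1))%:E <= sup_risk delta)%E.
Proof.
move=> mdelta.
have risk_le t : (risk t delta <= sup_risk delta)%E.
  by apply: ereal_sup_ubound; exists t.
have k0 := kappa_gt0.
have sq0 t x : 0 <= sqnorm (delta x - t) * gauss_rV 1 (x - t).
  by rewrite mulr_ge0 ?sqnorm_ge0 ?expR_ge0.
have risk0 t : (0 <= risk t delta)%E.
  apply: integral_ge0 => x _; rewrite lee_fin normal_rV_pdfE mulrCA.
  by rewrite mulr_ge0 ?(ltW k0).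
have S0 := le_trans (risk0 0) (risk_le 0).
(* An infinite supremum satisfies the bound at once; from here on it is a real number [s]. *)
move: S0 risk_le; case: (sup_risk delta) => [s| |]// S0 risk_le; last exact: leey.
rewrite lee_fin in S0; rewrite lee_fin.
have mdx t : measurable_fun setT (fun x : V => (sqnorm (delta x - t) * gauss_rV 1 (x - t))%:E).
  apply/measurable_EFinP; apply: measurable_funM; apply: measurableT_comp.
  - exact: measurable_sqnorm.
  - exact: (measurableT_comp (measurable_addrV (- t)) mdelta).
  - exact: measurable_gauss_rV.
  - exact: measurable_addrV.
have sq0e t x : (0 <= (sqnorm (delta x - t) * gauss_rV 1 (x - t))%:E)%E.
  by rewrite lee_fin.
have k0e : (0 <= kappa%:E)%E by rewrite lee_fin ltW.
have riskE t : (risk t delta = kappa%:E *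
    \int[mu]_x (sqnorm (delta x - t) * gauss_rV 1 (x - t))%:E)%E.
  rewrite -(ge0_integralZl _ measurableT (mdx t) (fun x _ => sq0e t x) k0e).
  by apply: eq_integral => x _; rewrite normal_rV_pdfE mulrCA EFinM.
have key eps : 0 < eps -> kappa * (n%:R * gauss_mass n 1) <= s * (1 + eps).
  move=> e0; have e1 : 0 < 1 + eps by lra.
  have [mI le1] := gauss_bayes_le mdelta e0.
  have Ze0 := gauss_mass_gt0 n e0.
  have G0 (t : V) : (0 <= (gauss_rV eps t)%:E)%E by rewrite lee_fin expR_ge0.
  have mG : measurable_fun setT (fun t : V => (gauss_rV eps t)%:E).
    by apply/measurable_EFinP; exact: measurable_gauss_rV.
  have sk0 : (0 <= (s / kappa)%:E)%E by rewrite lee_fin divr_ge0 ?(ltW k0).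
  have le2 : (\int[mu]_t \int[mu]_x
      (sqnorm (delta x - t) * gauss_rV 1 (x - t) * gauss_rV eps t)%:E <=
      (s / kappa * gauss_mass n eps)%:E)%E.
    rewrite EFinM -integral_gauss_massE// -(ge0_integralZl _ measurableT mG (fun t _ => G0 t) sk0).
    apply: ge0_le_integral.
    - exact: measurableT.
    - by move=> t _; apply: integral_ge0 => x _; rewrite lee_fin mulr_ge0 ?expR_ge0.
    - exact: mI.
    - by apply: measurable_funeM; exact: mG.
    move=> t _; under eq_integral do rewrite EFinM.
    rewrite (ge0_integralZr _ measurableT (mdx t) (fun x _ => sq0e t x) (G0 t)).
    apply: lee_wpmul2r; first exact: G0.
    have := risk_le t; rewrite riskE => h.
    by rewrite -(@lee_pmul2l _ kappa%:E) ?lte_fin// (le_trans h)// -EFinM lee_fin mulrC divfK ?gt_eqF.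
  have := le_trans le1 le2; rewrite lee_fin => h.
  have {}h : n%:R / (1 + eps) * gauss_mass n 1 <= s / kappa.
    by rewrite -(ler_pM2r Ze0) -[leLHS]mulrA.
  have := ler_wpM2r (ltW (mulr_gt0 k0 e1)) h.
  rewrite [leLHS](_ : _ = kappa * (n%:R * gauss_mass n 1)); last by field; rewrite gt_eqF.
  by rewrite [leRHS](_ : _ = s * (1 + eps)) //; field; rewrite gt_eqF.
rewrite leNgt; apply/negP => lt_s.
set K := _ * _ in lt_s key.
(* This [eps] makes s eps at most half the gap K - s, contradicting K <= s (1 + eps). The
   denominator has s + 1 because [s] may be 0. *)
have := key ((K - s) / (2 * (s + 1))).
have s1 : 0 < s + 1 by lra.
have d0 : 0 < K - s by lra.
move=> /(_ (divr_gt0 d0 _)) -/(_ _)/wrap[|h]; first by rewrite mulr_gt0.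
have : s * ((K - s) / (2 * (s + 1))) <= (K - s) / 2.
  rewrite (_ : _ * _ = (K - s) / 2 * (s / (s + 1))); last by field; lra.
  by rewrite ler_piMr ?divr_ge0 ?(ltW d0)// ler_pdivrMr// mul1r; lra.
by move: h; rewrite mulrDr mulr1; lra.
Qed.

End risk_lower_bound.

(** * Signs of derivatives and monotonicity of cosh *)

Section real_derivatives.
Context {R : realType}.

Lemma nonincreasing_derive_le0 (f : R -> R) (x D : R) : 0 < x ->
  is_derive x 1 f D -> (forall s t, 0 < s -> s <= t -> f t <= f s) -> D <= 0.
Proof.
move=> x0 [df <-] mono; rewrite /derive.
apply: limr_le; first exact: df.
near=> h; rewrite /= [h *: 1]mulr1.
have h0 : h != 0 by near: h; exact: nbhs_dnbhs_neq.
(* Monotonicity is assumed on positive reals only, so x + h must stay positive. *)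
have hx : - x < h.
  have : `|h| < x by near: h; exact: dnbhs0_lt.
  by rewrite ltr_norml => /andP[].
move: h0; rewrite neq_lt => /orP[h0|h0].
  by rewrite nmulr_rle0 ?invr_lt0// subr_ge0; apply: mono; lra.
by rewrite pmulr_rle0 ?invr_gt0// subr_le0; apply: mono; lra.
Unshelve. all: by end_near. Qed.

Lemma nondecreasing_derive_ge0 (f : R -> R) (x D : R) : 0 < x ->
  is_derive x 1 f D -> (forall s t, 0 < s -> s <= t -> f s <= f t) -> 0 <= D.
Proof.
move=> x0 /is_deriveN df mono; rewrite -oppr_le0.
by apply: nonincreasing_derive_le0 df _ => // s t s0 st; rewrite lerN2 mono.
Qed.

(** The chain rule applied to s -> f(- s) gives D = - D. *)
Lemma derive0_even (f : R -> R) (D : R) :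
  is_derive (0 : R) (1 : R) f D -> (forall s, f (- s) = f s) -> D = 0.
Proof.
move=> df fN.
have dN : is_derive (0 : R) (1 : R) (f \o -%R) (D * (- 1)).
  by apply: is_derive1_comp; rewrite oppr0.
have fE : f \o -%R = f by apply/funext => s; exact: fN.
move: df dN; rewrite fE => -[_ <-] [_]; lra.
Qed.

(** With a = exp(s y) and b = exp(t y), the difference factors as (b - a) (1 - 1 / (a b)); the case
    y < 0 follows by symmetry. *)
Lemma cosh_nondecreasing (s t y : R) : 0 <= s -> s <= t ->
  expR (s * y) + expR (- (s * y)) <= expR (t * y) + expR (- (t * y)).
Proof.
wlog y0 : y / 0 <= y => [H|] s0 st.
  have [|y0] := leP 0 y; first by move=> y0; exact: H.
  have := H (- y); rewrite oppr_ge0 (ltW y0) !mulrN !opprK => /(_ isT s0 st).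
  by rewrite [X in X <= _]addrC [X in _ <= X]addrC.
set a := expR (s * y); set b := expR (t * y).
have a1 : 1 <= a by rewrite -expR0 ler_expR mulr_ge0.
have ab : a <= b by rewrite ler_expR ler_wpM2r.
rewrite !expRN -/a -/b -subr_ge0.
have -> : b + b^-1 - (a + a^-1) = (b - a) * (1 - (a * b)^-1).
  by field; rewrite !gt_eqF ?expR_gt0.
rewrite mulr_ge0 ?subr_ge0// invf_le1 ?mulr_gt0 ?expR_gt0//.
by rewrite mulr_ege1// (le_trans a1).
Qed.

End real_derivatives.

(** * Regularity of the radial profile of the marginal *)

Section radial_marginal.
Context {R : realType}.
Variables (d : nat) (j : 'I_d) (prior f : R -> R).
Local Notation V := 'rV[R]_d.
Local Notation mu := (lebesgue_rV d).
Local Notation kappa := ((2 * pi) `^ (- (d%:R / 2)) : R).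
Local Notation e := (delta_mx ord0 j : V).
Hypotheses (prior_ge0 : forall t : R, 0 <= t -> 0 <= prior t)
  (prior_meas : measurable_fun (`[0, +oo[ : set R) prior)
  (marginal_fin : forall x : V, (0 < marginal prior x < +oo)%E)
  (marginal_f : forall x : V, marginal prior x = (f (sqnorm x))%:E).

Lemma sqnorm_delta (s : R) : sqnorm (s *: e) = s ^+ 2.
Proof.
rewrite -[s *: e]add0r sqnormD_delta mxE mulr0 addr0.
by rewrite /sqnorm big1 ?add0r// => i _; rewrite mxE expr0n.
Qed.

Lemma sqnormN (x : V) : sqnorm (- x) = sqnorm x.
Proof. by apply: eq_bigr => i _; rewrite mxE sqrrN. Qed.

Let psi (y : V) : R := kappa * (gauss_rV 1 y * prior (sqnorm y)).

Let psi_ge0 y : 0 <= psi y.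
Proof.
by rewrite mulr_ge0 ?(ltW (kappa_gt0 _))// mulr_ge0 ?expR_ge0 ?prior_ge0 ?sqnorm_ge0.
Qed.

Let mpsi : measurable_fun setT psi.
Proof.
apply: measurable_funM => //; apply: measurable_funM; first exact: measurable_gauss_rV.
apply: measurable_comp prior_meas _ => //; last exact: measurable_sqnorm.
by move=> _ [y _ <-]; rewrite /= in_itv/= sqnorm_ge0.
Qed.

Let F (s : R) (y : V) : R := expR (s * y ord0 j) * psi y.

Let F_ge0 s y : 0 <= F s y.
Proof. by rewrite mulr_ge0 ?expR_ge0. Qed.

Let mF s : measurable_fun setT (F s).
Proof.
apply: measurable_funM; last exact: mpsi.
apply: measurableT_comp => //; apply: measurable_funM => //.
exact: measurable_coord.
Qed.

(** Tilting along the axis [e] exhibits the marginal as a Gaussian factor times the Laplace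
    transform of [psi], the centred Gaussian density weighted by the prior. *)
Let marginalE s : (marginal prior (s *: e) =
  (expR (- (s ^+ 2 / 2)))%:E * \int[mu]_y (F s y)%:E)%E.
Proof.
have F0 y : (0 <= (F s y)%:E)%E by rewrite lee_fin mulr_ge0 ?expR_ge0.
have mFE : measurable_fun setT (fun y => (F s y)%:E) by apply/measurable_EFinP.
have E0 : (0 <= (expR (- (s ^+ 2 / 2)))%:E)%E by rewrite lee_fin expR_ge0.
rewrite -(ge0_integralZl _ measurableT mFE (fun y _ => F0 y) E0).
apply: eq_integral => y _; congr EFin.
have -> : normal_rV_pdf y (s *: e) = kappa * gauss_rV 1 (y - s *: e).
  by rewrite normal_rV_pdfE /gauss_rV -[s *: e - y]opprB sqnormN.
rewrite gauss_rV_shift /F /psi mul1r expRD; ring.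
Qed.

Let intF s : mu.-integrable setT (EFin \o F s).
Proof.
apply/integrableP; split; first exact/measurable_EFinP.
under eq_integral do rewrite /= (ger0_norm (F_ge0 _ _)).
have /andP[_] := marginal_fin (s *: e); rewrite marginalE.
case: (\int[mu]_y _)%E => [r||] //=; rewrite ?ltry//.
by rewrite gt0_muley ?lte_fin ?expR_gt0.
Qed.

Let M (s : R) : R := \int[mu]_y F s y.

Let fE s : f (s ^+ 2) = expR (- (s ^+ 2 / 2)) * M s.
Proof.
have := marginal_f (s *: e); rewrite marginalE (EFin_Rintegral (intF s)).
by rewrite -EFinM sqnorm_delta => -[].
Qed.

Let ME s : M s = f (s ^+ 2) * expR (s ^+ 2 / 2).
Proof. by rewrite fE mulrAC -expRD addNr expR0 mul1r. Qed.

(** Differentiation under the integral. For |t - s| < 1 the derivative of [F] in [t] is dominated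
    with exponent |s| + 2: one unit bounds |y_j|, the other the distance from [t] to [s]. [G] covers
    both signs of y_j. *)
Let derivable_M s : derivable M s 1.
Proof.
pose G (y : V) := F (`|s| + 2) y + F (- (`|s| + 2)) y.
have intG : mu.-integrable setT (EFin \o G).
  exact: (integrableD measurableT (intF _) (intF _)).
have dF t y : is_derive t (1 : R) (F ^~ y) (y ord0 j * F t y).
  rewrite /F; set c := psi y; set z := y ord0 j.
  apply: is_derive_eq.
  by rewrite /GRing.scale/=; ring.
have Is : `]s - 1, s + 1[%classic s by rewrite /= in_itv/=; lra.
apply: (@derivable_under_integral R _ _ mu F setT measurableT s (s - 1) (s + 1) Is
  (fun t _ => intF t) (fun t y _ _ => @ex_derive _ _ _ _ _ _ _ (dF t y)) G _ intG).
  by move=> y; rewrite addr_ge0.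
move=> t y; rewrite /= in_itv/= => /andP[t1 t2] _.
rewrite partial1of2E; have [_ ->] := dF t y.
rewrite /G /F -mulrDl mulrA normrM (ger0_norm (psi_ge0 y)) ler_wpM2r// normrM.
rewrite (ger0_norm (expR_ge0 _)).
apply: (@le_trans _ _ (expR ((`|s| + 2) * `|y ord0 j|))).
  apply: (@le_trans _ _ (expR `|y ord0 j| * expR (t * y ord0 j))).
    by rewrite ler_wpM2r ?expR_ge0// ler_expR_id.
  rewrite -expRD ler_expR (_ : `|s| + 2 = 1 + (`|s| + 1)); last by ring.
  rewrite [leRHS]mulrDl mul1r lerD2l (le_trans (ler_norm _))// normrM ler_wpM2r//.
  rewrite ler_norml; have := ler_norm s; have := ler_norm (- s); rewrite normrN; lra.
case: (ger0P (y ord0 j)) => _; first by rewrite lerDl expR_ge0.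
by rewrite mulrN -mulNr lerDr expR_ge0.
Qed.

Lemma radial_gt0 t : 0 <= t -> 0 < f t.
Proof.
move=> t0; have /andP[] := marginal_fin (Num.sqrt t *: e).
by rewrite marginal_f sqnorm_delta sqr_sqrtr// lte_fin.
Qed.

Lemma radial_derivable t : 0 < t -> derivable f t 1.
Proof.
move=> t0.
apply: (@near_eq_derivable _ _ _ (fun u : R => expR (- (u / 2)) * M (Num.sqrt u)) f t 1).
  near=> u; have u0 : 0 < u by near: u; exact: lt_nbhsr.
  by rewrite -[in RHS](sqr_sqrtr (ltW u0)) fE sqr_sqrtr// ltW.
apply: derivableM; first exact: ex_derive.
have dM : is_derive (Num.sqrt t) (1 : R) M ('D_1 M (Num.sqrt t)).
  by apply: DeriveDef.
have := is_derive1_comp dM (is_derive1_sqrt t0).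
by case.
Unshelve. all: by end_near. Qed.

(** [f] is determined by the marginal on nonnegative reals only, so at the origin the even function
    s -> f(s^2) is differentiated in its place. *)
Lemma radial_sqr_derive0 : is_derive (0 : R) (1 : R) (fun s : R => f (s ^+ 2)) 0.
Proof.
have dfs : derivable (fun s : R => f (s ^+ 2)) 0 1.
  rewrite (_ : (fun s : R => _) = (fun s : R => expR (- (s ^+ 2 / 2)) * M s)); last first.
    by apply/funext => s; exact: fE.
  by apply: derivableM => //; exact: ex_derive.
have := DeriveDef dfs erefl => df.
by have := derive0_even df (fun s => congr1 f (sqrrN s)); move=> {2}<-.
Qed.

(** The quantity is M(sqrt t). As [M] is even, 2 M(u) integrates exp(u y_j) + exp(- u y_j) against
    [psi], and this grows with u >= 0. *)
Lemma radial_expR_nondecreasing s t : 0 <= s -> s <= t ->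
  f s * expR (s / 2) <= f t * expR (t / 2).
Proof.
move=> s0 st; have t0 := le_trans s0 st.
rewrite -(sqr_sqrtr s0) -(sqr_sqrtr t0) -!ME.
have {}st : Num.sqrt s <= Num.sqrt t by rewrite ler_wsqrtr.
move: (Num.sqrt s) (Num.sqrt t) (sqrtr_ge0 s) st => {s0 t0} {}s {}t s0 st.
have MN u : M (- u) = M u by rewrite !ME sqrrN.
have M2 u : M u *+ 2 = \int[mu]_y (F u y + F (- u) y).
  by rewrite (RintegralD measurableT (intF _) (intF _)) -/(M (- u)) MN mulr2n.
rewrite -(ler_pMn2r (ltn0Sn 1)) !M2.
have intFF u := integrableD measurableT (intF u) (intF (- u)).
apply: (le_Rintegral measurableT (intFF s) (intFF t)) => y _.
rewrite /F -!mulrDl ler_wpM2r// !mulNr.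
exact: cosh_nondecreasing.
Qed.

End radial_marginal.

(** * Directional derivatives of radial functions *)

Section line_derivatives.
Context {R : realType}.
Variable d : nat.
Local Notation V := 'rV[R]_d.

Lemma is_derive_of_line (g : V -> R) (y e : V) (D : R) :
  is_derive (0 : R) (1 : R) (fun t => g (t *: e + y)) D -> is_derive y e g D.
Proof.
move=> dg.
have E : (fun h : R => h^-1 *: (g (h *: e + y) - g y)) =
  (fun h : R => h^-1 *: (g ((h *: 1 + 0) *: e + y) - g (0 *: e + y))).
  by apply/funext => h; rewrite addr0 [h *: 1]mulr1 scale0r add0r.
by split; rewrite /derivable /derive /= E; [exact: (@ex_derive _ _ _ _ _ _ _ dg)
  |exact: (@derive_val _ _ _ _ _ _ _ dg)].
Qed.

Lemma is_derive_translate (g : V -> R) (y e c : V) (D : R) :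
  is_derive (y - c) e g D -> is_derive y e (fun x => g (x - c)) D.
Proof.
move=> dg.
have E : (fun h : R => h^-1 *: (g (h *: e + y - c) - g (y - c))) =
  (fun h : R => h^-1 *: (g (h *: e + (y - c)) - g (y - c))).
  by apply/funext => h; rewrite addrA.
by split; rewrite /derivable /derive /= E; [exact: (@ex_derive _ _ _ _ _ _ _ dg)
  |exact: (@derive_val _ _ _ _ _ _ _ dg)].
Qed.

Lemma sqnorm_eq0 (u : V) : (sqnorm u == 0) = (u == 0).
Proof.
apply/idP/eqP => [|->]; last first.
  by rewrite /sqnorm big1// => i _; rewrite mxE expr0n.
rewrite /sqnorm psumr_eq0 => [/allP u0|i _]; last exact: sqr_ge0.
apply/rowP => i; apply/eqP; rewrite mxE -sqrf_eq0.
by apply: u0; rewrite mem_index_enum.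
Qed.

Lemma sqr_coord_le (u : V) j : u ord0 j ^+ 2 <= sqnorm u.
Proof.
by rewrite /sqnorm (bigD1 j)//= lerDl sumr_ge0// => i _; exact: sqr_ge0.
Qed.

Lemma is_derive_sqnorm_line (u : V) j :
  is_derive (0 : R) (1 : R) (fun t => sqnorm (t *: delta_mx ord0 j + u)) (2 * u ord0 j).
Proof.
have -> : (fun t : R => sqnorm (t *: delta_mx ord0 j + u)) =
    (fun t => sqnorm u + 2 * t * u ord0 j + t ^+ 2).
  by apply/funext => t; rewrite addrC sqnormD_delta.
apply: is_derive_eq.
by rewrite /GRing.scale/=; ring.
Qed.

Lemma radial_is_derive (g : R -> R) (D : R) (u : V) j : 0 < sqnorm u ->
  is_derive (sqnorm u) 1 g D ->
  is_derive u (delta_mx ord0 j) (fun x => g (sqnorm x)) (D * (2 * u ord0 j)).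
Proof.
move=> u0 dg; apply: is_derive_of_line.
apply: (@is_derive1_comp _ g (fun t => sqnorm (t *: delta_mx ord0 j + u))).
  by rewrite scale0r add0r.
exact: is_derive_sqnorm_line.
Qed.

(** On a coordinate axis [sqnorm] is s^2, which gives the derivative at the origin without
    differentiating [g] at 0. *)
Lemma radial_is_derive0 (g : R -> R) j :
  is_derive (0 : R) (1 : R) (fun s => g (s ^+ 2)) 0 ->
  is_derive (0 : V) (delta_mx ord0 j) (fun x => g (sqnorm x)) 0.
Proof.
move=> dg; apply: is_derive_of_line.
rewrite (_ : (fun t : R => _) = (fun s => g (s ^+ 2)))//.
by apply/funext => t; rewrite addr0 sqnorm_delta.
Qed.

End line_derivatives.

(** * The radial vector field al(|u|^2) u, its partial derivatives and its divergence *)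

Section radial_field.
Context {R : realType}.
Variable d : nat.
Local Notation V := 'rV[R]_d.
Variables (al : R -> R) (K : R).
Hypotheses (al0 : al 0 = 0) (al_ge0 : forall q, 0 <= q -> 0 <= al q)
  (al_leK : forall q, 0 <= q -> al q <= K)
  (al_noninc : forall s t, 0 < s -> s <= t -> al t <= al s)
  (qal_nondec : forall s t, 0 < s -> s <= t -> s * al s <= t * al t)
  (al_der : forall t, 0 < t -> derivable al t 1).

Definition radial_field (u : V) j : R := al (sqnorm u) * u ord0 j.

Definition radial_field_partial (u : V) j : R :=
  'D_(delta_mx ord0 j) (radial_field^~ j) u.

Let al_derive_sign t : 0 < t -> 'D_1 al t <= 0 /\ 0 <= al t + t * 'D_1 al t.
Proof.
move=> t0; have dal : is_derive t (1 : R) al ('D_1 al t).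
  by apply: DeriveDef => //; exact: al_der.
split; first exact: nonincreasing_derive_le0 dal al_noninc.
have dq : is_derive t (1 : R) (id * al) (t *: 'D_1 al t + al t *: 1).
  exact: is_deriveM.
have := nondecreasing_derive_ge0 t0 dq qal_nondec.
by rewrite /GRing.scale/= mulr1 addrC.
Qed.

Let radial_field_is_derive_neq0 (u : V) j : 0 < sqnorm u ->
  is_derive u (delta_mx ord0 j) (radial_field^~ j)
    (al (sqnorm u) + 2 * 'D_1 al (sqnorm u) * u ord0 j ^+ 2).
Proof.
move=> u0; have dal : is_derive (sqnorm u) (1 : R) al ('D_1 al (sqnorm u)).
  by apply: DeriveDef => //; exact: al_der.
have [dM DM] := is_deriveM (radial_is_derive j u0 dal) (is_derive_coord u j).
split; first exact: dM.
by apply: etrans DM _; rewrite /GRing.scale/=; ring.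
Qed.

(** The difference quotient at the origin along axis [j] is al(h^2), so the partial derivative is
    the right limit of [al] at 0, which exists because [al] is monotone and bounded. *)
Let radial_field_is_derive0 j :
  exists2 l : R, 0 <= l <= K & is_derive (0 : V) (delta_mx ord0 j) (radial_field^~ j) l.
Proof.
have cal : cvg (al x @[x --> (0 : R)^'+]).
  apply: nonincreasing_at_right_is_cvgr.
    apply: nearW => x s t; rewrite !in_itv/= => /andP[s0 _] _; exact: al_noninc.
  apply: nearW => x; exists K => z [y /=]; rewrite in_itv/= => /andP[y0 _] <-.
  by rewrite al_leK// ltW.
pose l := lim (al x @[x --> (0 : R)^'+]).
have csq : (h ^+ 2 : R) @[h --> (0 : R)^'] --> (0 : R)^'+.
  (* For |h| < 1 one has h^2 <= |h|, hence this radius. *)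
  move=> A [e /= e0 eA]; exists (Num.min 1 e) => /=; first by rewrite lt_min ltr01.
  move=> h /=; rewrite sub0r normrN lt_min => /andP[h1 he] h0.
  have h2 : 0 < h ^+ 2 by rewrite exprn_even_gt0.
  apply: eA => //=; rewrite sub0r normrN ger0_norm ?ltW//.
  rewrite -real_normK ?num_real// (le_lt_trans _ he)// expr2 ler_piMl//.
  exact: ltW.
have cl : al (h ^+ 2) @[h --> (0 : R)^'] --> l.
  exact: (cvg_comp (fun h : R => h ^+ 2) al csq cal).
have cq : (fun h : R => h^-1 *: (radial_field (h *: delta_mx ord0 j + 0) j - radial_field 0 j))
    @ 0^' --> l.
  apply: cvg_trans cl; apply: near_eq_cvg; near=> h.
  have h0 : h != 0 by near: h; exact: nbhs_dnbhs_neq.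
  rewrite /radial_field addr0 sqnorm_delta !mxE !eqxx mulr1 mulr0 subr0.
  by rewrite /GRing.scale/= mulrCA mulVf// mulr1.
exists l; last by split; [exact: (cvgP _ cq)|exact: (cvg_lim _ cq)].
apply/andP; split.
  apply: limr_ge; first exact: cal.
  by apply: filterS (nbhs_right_gt 0) => x x0; rewrite al_ge0// ltW.
apply: limr_le; first exact: cal.
by apply: filterS (nbhs_right_gt 0) => x x0; rewrite al_leK// ltW.
Unshelve. all: by end_near. Qed.

Lemma radial_field_is_derive (u : V) j :
  is_derive u (delta_mx ord0 j) (radial_field^~ j) (radial_field_partial u j).
Proof.
apply: DeriveDef => //.
have [/eqP|u0] := eqVneq (sqnorm u) 0.
  by rewrite sqnorm_eq0 => /eqP ->; have [l _ []] := radial_field_is_derive0 j.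
have {}u0 : 0 < sqnorm u by rewrite lt_def u0 sqnorm_ge0.
by have [] := radial_field_is_derive_neq0 j u0.
Qed.

(** Off the origin the derivative is al + 2 al' u_j^2 with al' <= 0, u_j^2 <= q and q al' >= - al,
    so it lies between - al and al. *)
Lemma radial_field_partial_le (u : V) j : `|radial_field_partial u j| <= K.
Proof.
rewrite /radial_field_partial; have [/eqP|u0] := eqVneq (sqnorm u) 0.
  rewrite sqnorm_eq0 => /eqP ->; have [l /andP[l0 lK] [_ ->]] := radial_field_is_derive0 j.
  by rewrite ger0_norm.
have {}u0 : 0 < sqnorm u by rewrite lt_def u0 sqnorm_ge0.
have [_ ->] := radial_field_is_derive_neq0 j u0.
have [D0 D1] := al_derive_sign u0.
have := al_leK (ltW u0); have := sqr_coord_le u j; have := sqr_ge0 (u ord0 j).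
move: (u ord0 j ^+ 2) (sqnorm u) D0 D1 => z q D0 D1 z0 zq alK.
have : 'D_1 al q * q <= 'D_1 al q * z by rewrite ler_wnM2l.
have : 'D_1 al q * z <= 0 by rewrite mulr_le0_ge0.
by rewrite ler_norml mulrC in D1 *; lra.
Qed.

(** Off the origin the sum is d al + 2 q al', and q al' >= - al because q al(q) is nondecreasing. At
    the origin [al 0] is 0 and the partial derivatives are nonnegative. *)
Lemma radial_field_div_ge (u : V) :
  (d%:R - 2) * al (sqnorm u) <= \sum_(j < d) radial_field_partial u j.
Proof.
rewrite /radial_field_partial; have [q0|u0] := eqVneq (sqnorm u) 0.
  have /eqP uE : u == 0 by rewrite -sqnorm_eq0 q0.
  rewrite q0 al0 mulr0 uE.
  apply: sumr_ge0 => j _.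
  by have [l /andP[l0 lK] [_ ->]] := radial_field_is_derive0 j.
have {}u0 : 0 < sqnorm u by rewrite lt_def u0 sqnorm_ge0.
rewrite (eq_bigr (fun j => al (sqnorm u) + 2 * 'D_1 al (sqnorm u) * u ord0 j ^+ 2)).
  rewrite big_split/= sumr_const card_ord -mulr_sumr -/(sqnorm u) -mulr_natl.
  have [_ D1] := al_derive_sign u0; lra.
by move=> j _; have [_ ->] := radial_field_is_derive_neq0 j u0.
Qed.

Lemma radial_field_sqr_le (u : V) j : radial_field u j ^+ 2 <= K * (sqnorm u * al (sqnorm u)).
Proof.
have q0 := sqnorm_ge0 u; rewrite /radial_field exprMn.
apply: (@le_trans _ _ (al (sqnorm u) ^+ 2 * sqnorm u)).
  by rewrite ler_wpM2l ?sqr_ge0 ?sqr_coord_le.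
rewrite expr2 -mulrA [_ * sqnorm u]mulrC ler_wpM2r ?al_leK//.
by rewrite mulr_ge0 ?al_ge0.
Qed.

End radial_field.

(** * The pointwise inequality for mixtures of radial fields *)

Section pointwise_inequality.
Context {R : realType}.
Variable d : nat.
Local Notation V := 'rV[R]_d.

Let dotV (u v : V) : R := \sum_(j < d) u ord0 j * v ord0 j.

Let sqnorm_sub (u v : V) : sqnorm (u - v) = sqnorm u + sqnorm v - 2 * dotV u v.
Proof.
rewrite /sqnorm /dotV mulr_sumr -big_split -sumrB/=.
by apply: eq_bigr => j _; rewrite !mxE; ring.
Qed.

Lemma sqnormD_le (e : R) (u v : V) : 0 < e ->
  sqnorm (u + v) <= (1 + e^-1) * sqnorm u + (1 + e) * sqnorm v.
Proof.
move=> e0; rewrite /sqnorm !mulr_sumr -big_split/=; apply: ler_sum => j _.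
rewrite mxE -subr_ge0.
rewrite (_ : _ - _ = e^-1 * (u ord0 j - e * v ord0 j) ^+ 2); last first.
  by field; rewrite gt_eqF.
by rewrite mulr_ge0 ?sqr_ge0// invr_ge0 ltW.
Qed.

(** Both sides are written as double sums with weights p_i p_l, the left one after symmetrising in i
    and l, and are compared term by term. *)
Lemma sqr_sum_dominated k (p z : 'I_k -> R) (u : 'I_k -> V) (lam : R) :
  (forall i, 0 <= p i) -> \sum_i p i = 1 ->
  (forall i j, z i + z j <= 2 * lam * dotV (u i) (u j)) ->
  \sum_i p i * z i <= lam * \sum_(j < d) (\sum_i p i * u i ord0 j) ^+ 2.
Proof.
move=> p0 p1 zu.
have -> : \sum_(j < d) (\sum_i p i * u i ord0 j) ^+ 2 =
    \sum_i \sum_l p i * p l * dotV (u i) (u l).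
  under eq_bigr => j _.
    rewrite expr2 mulr_suml; under eq_bigr do rewrite mulr_sumr; over.
  rewrite exchange_big/=; apply: eq_bigr => i _; rewrite exchange_big/=.
  apply: eq_bigr => l _; rewrite /dotV mulr_sumr; apply: eq_bigr => j _; ring.
have -> : \sum_i p i * z i = \sum_i \sum_l p i * p l * ((z i + z l) / 2).
  have E1 : \sum_i \sum_l p i * p l * (z i / 2) = (\sum_i p i * z i) / 2.
    rewrite mulr_suml; apply: eq_bigr => i _.
    by rewrite -mulr_suml -mulr_sumr p1 mulr1 mulrA.
  have E2 : \sum_i \sum_l p i * p l * (z l / 2) = (\sum_i p i * z i) / 2.
    rewrite exchange_big/= -E1; apply: eq_bigr => i _; apply: eq_bigr => l _.
    by rewrite [p l * _]mulrC.
  rewrite [LHS](_ : _ = (\sum_i p i * z i) / 2 + (\sum_i p i * z i) / 2); last by field.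
  rewrite -{1}E1 -E2 -big_split/=; apply: eq_bigr => i _; rewrite -big_split/=.
  by apply: eq_bigr => l _; field.
rewrite mulr_sumr; apply: ler_sum => i _; rewrite mulr_sumr; apply: ler_sum => l _.
rewrite [leRHS]mulrCA ler_wpM2l ?mulr_ge0//.
have := zu i l; lra.
Qed.

Variables (k : nat) (p : 'I_k -> R) (u : 'I_k -> V) (al : R -> R) (b c rho D T : R).
Hypotheses (p_ge0 : forall i, 0 <= p i) (p_sum1 : \sum_i p i = 1)
  (al_ge0 : forall q, 0 <= q -> 0 <= al q)
  (al_noninc : forall s t, 0 < s -> s <= t -> al t <= al s)
  (qal_nondec : forall s t, 0 < s -> s <= t -> s * al s <= t * al t)
  (qal_le : forall q, 0 <= q -> q * al q <= b)
  (c_gt0 : 0 < c) (rho_01 : 0 < rho < 1)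
  (rho_le : rho * (2 * b - 2 * c) <= 2 * c - b)
  (u_diam : forall i j, sqnorm (u i - u j) <= D)
  (T_gt0 : 0 < T) (alT : T * al T = c) (DT : D * (1 + rho^-1) ^+ 2 <= T).

Let q i := sqnorm (u i).

(** One large r_i forces q_i > T, and then every target is far. The threshold D (1 + 1/rho)^2 is
    exactly what turns q_i <= (1 + 1/rho) D + (1 + rho) q_j into D <= rho^2 q_j. *)
Let far i j : c < q i * al (q i) -> D <= rho ^+ 2 * q j /\ 0 < q j.
Proof.
move=> ri; have /andP[rho0 rho1] := rho_01.
have Tq : T < q i.
  rewrite ltNge; apply/negP => qT.
  have := sqnorm_ge0 (u i); rewrite le_eqVlt => /predU1P[q0|q0].
    by move: ri; rewrite /q -q0 mul0r ltNge (ltW c_gt0).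
  by have := qal_nondec q0 qT; rewrite alT leNgt ri.
have D0 : 0 <= D by apply: le_trans (u_diam i i); exact: sqnorm_ge0.
(* The decomposition u_i = (u_i - u_j) + u_j, with parameter [rho] in [sqnormD_le]. *)
have qi : q i <= (1 + rho^-1) * D + (1 + rho) * q j.
  rewrite /q -[in X in X <= _](subrK (u j) (u i)) (le_trans (sqnormD_le _ _ rho0))//.
  by rewrite lerD2r ler_wpM2l// addr_ge0// invr_ge0 ltW.
have Dq : D <= rho ^+ 2 * q j.
  rewrite leNgt; apply/negP => qD.
  have qD' : q j <= D / rho ^+ 2 by rewrite ler_pdivlMr ?exprn_gt0// mulrC ltW.
  have r1 : 0 <= 1 + rho by lra.
  have := ler_wpM2l r1 qD'.
  have E : (1 + rho) * (D / rho ^+ 2) = D * (1 + rho^-1) ^+ 2 - (1 + rho^-1) * D.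
    by field; rewrite gt_eqF.
  by rewrite E; move: DT Tq qi; lra.
split=> //.
have qj := sqnorm_ge0 (u j); rewrite lt_def qj andbT; apply/eqP => qj0.
move: Dq qi; rewrite qj0 !mulr0 addr0 => Dq; have -> : D = 0 by lra.
by rewrite mulr0; move: T_gt0 Tq; lra.
Qed.

Lemma mixture_pointwise_le :
  2 * \sum_i p i * (q i * al (q i) ^+ 2 - c * al (q i)) <=
  \sum_(j < d) (\sum_i p i * (al (q i) * u i ord0 j)) ^+ 2.
Proof.
have /andP[rho0 rho1] := rho_01.
have q0 i : 0 <= q i by exact: sqnorm_ge0.
(* If every r_i is at most [c], each term on the left is nonpositive. *)
have [[i ri]|small] := pselect (exists i, c < q i * al (q i)); last first.
  apply: (@le_trans _ _ 0); last by apply: sumr_ge0 => j _; exact: sqr_ge0.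
  rewrite pmulr_rle0//; apply: sumr_le0 => i _.
  rewrite mulr_ge0_le0// (_ : _ - _ = (q i * al (q i) - c) * al (q i)); last by ring.
  rewrite mulr_le0_ge0 ?al_ge0// subr_le0 leNgt; apply/negP => ri.
  by apply: small; exists i.
have Dq j := (far j ri).1; have {}q_gt0 j := (far j ri).2.
rewrite -(ler_pM2l (_ : 0 < 1 + rho)); last by lra.
(* The pairwise form of sum_i p_i |v_i|^2 <= (1 + rho) |sum_i p_i v_i|^2, as [sqr_sum_dominated]
   requires. *)
have dom j l : q j * al (q j) ^+ 2 + q l * al (q l) ^+ 2 <=
    2 * (1 + rho) * dotV (al (q j) *: u j) (al (q l) *: u l).
  have E : 2 * dotV (al (q j) *: u j) (al (q l) *: u l) =
      al (q j) * al (q l) * (q j + q l - sqnorm (u j - u l)).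
    rewrite sqnorm_sub -/(q j) -/(q l).
    rewrite (_ : dotV (_ *: _) _ = al (q j) * al (q l) * dotV (u j) (u l)); first by ring.
    rewrite /dotV mulr_sumr; apply: eq_bigr => i' _; rewrite !mxE; ring.
  rewrite [2 * _]mulrC -mulrA E.
  have del := u_diam j l; have Dj := Dq j; have Dl := Dq l.
  set A := al (q j) * al (q l); set de := sqnorm _ in del *.
  have A0 : 0 <= A by rewrite mulr_ge0 ?al_ge0.
  (* Since [al] and q al(q) are oppositely ordered, q_j al_j^2 + q_l al_l^2 <= al_j al_l (q_j +
     q_l). *)
  have cov : (al (q j) - al (q l)) * (q j * al (q j) - q l * al (q l)) <= 0.
    have [jl|lj] := leP (q j) (q l).
      rewrite mulr_ge0_le0// ?subr_ge0 ?subr_le0; first exact: al_noninc.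
      exact: qal_nondec.
    rewrite mulr_le0_ge0// ?subr_ge0 ?subr_le0; first exact: al_noninc (ltW lj).
    exact: qal_nondec (ltW lj).
  (* The chain is (1 + rho) de <= 2 D <= rho^2 (q_j + q_l) <= rho (q_j + q_l). *)
  have de_le : (1 + rho) * de <= rho * (q j + q l).
    have de0 : 0 <= de by exact: sqnorm_ge0.
    have h1 : (1 + rho) * de <= 2 * D.
      by rewrite (@le_trans _ _ (2 * de)) ?ler_wpM2r ?ler_wpM2l//; lra.
    have h2 : rho ^+ 2 * (q j + q l) <= rho * (q j + q l).
      by rewrite ler_wpM2r ?addr_ge0// expr2 ler_piMl ?ltW.
    by rewrite (le_trans h1)// (le_trans _ h2)// mulrDr; lra.
  have : A * ((1 + rho) * de) <= A * (rho * (q j + q l)) by rewrite ler_wpM2l.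
  rewrite /A in A0 *; nra.
have sE : \sum_(j < d) (\sum_i p i * (al (q i) * u i ord0 j)) ^+ 2 =
    \sum_(j < d) (\sum_i p i * (al (q i) *: u i) ord0 j) ^+ 2.
  by apply: eq_bigr => j _; congr (_ ^+ 2); apply: eq_bigr => l _; rewrite mxE.
rewrite sE; apply: le_trans (sqr_sum_dominated p_ge0 p_sum1 dom).
rewrite mulrA mulr_sumr; apply: ler_sum => j _.
rewrite [leLHS]mulrCA ler_wpM2l//.
rewrite [leLHS](_ : _ = (2 * (1 + rho) * (q j * al (q j) - c)) * al (q j)); last by ring.
rewrite expr2 mulrA ler_wpM2r ?al_ge0//.
(* What remains is 2 (1 + rho) (r - c) <= r, that is (1 + 2 rho) r <= 2 (1 + rho) c. At r = b this
   is the hypothesis on [rho]. *)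
have := qal_le (q0 j); set r := _ * al _ => rb.
have : (1 + 2 * rho) * r <= (1 + 2 * rho) * b by rewrite ler_wpM2l//; lra.
by move: rho_le; rewrite !mulrBr; lra.
Qed.

End pointwise_inequality.

(** * From a differential inequality to a risk bound *)

Section sure.
Context {R : realType}.
Variable n : nat.
Local Notation V := 'rV[R]_n.
Local Notation mu := (lebesgue_rV n).
Local Notation kappa := ((2 * pi) `^ (- (n%:R / 2)) : R).

(* Stein's unbiased risk estimate. *)
Lemma sure_risk_le (gam dgam : V -> 'I_n -> R) (B L : R) (t : V) :
  (forall j, measurable_fun setT (gam^~ j)) ->
  (forall x j, is_derive x (delta_mx ord0 j) (gam^~ j) (dgam x j)) ->
  (forall x j, `|gam x j| <= B) -> (forall x j, `|dgam x j| <= L) ->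
  (forall x, 2 * (\sum_j dgam x j) + \sum_j gam x j ^+ 2 <= 0) ->
  (risk t (fun x => x + \row_j gam x j)%R <= (kappa * (n%:R * gauss_mass n 1))%:E)%E.
Proof.
move=> mgam dgamE gamB dgamL gam_le.
pose g j (y : V) := gam (y + t) j; pose g' j (y : V) := dgam (y + t) j.
have mg j : measurable_fun setT (g j).
  exact: (measurableT_comp (mgam j) (measurable_addrV t)).
have dg j y : is_derive y (delta_mx ord0 j) (g j) (g' j y).
  have := @is_derive_translate _ _ (gam^~ j) y (delta_mx ord0 j) (- t) (dgam (y + t) j).
  by rewrite opprK; apply.
have gA j y : `|g j y| <= B * expR `|y ord0 j|.
  have B0 : 0 <= B by apply: le_trans (gamB (y + t) j).
  by rewrite (le_trans (gamB _ _))// ler_peMr// -expR0 ler_expR.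
have steinE j := stein_identity ltr01 (mg j) (gA j) (dg j) (fun y => dgamL (y + t) j).
have mgauss : measurable_fun setT (@gauss_rV R n 1) by exact: measurable_gauss_rV.
have intg2 j : mu.-integrable setT (EFin \o (fun y => gauss_rV 1 y * g j y ^+ 2)).
  have := integrableZl measurableT (B ^+ 2) (integrable_gauss_rV n (@ltr01 R)).
  apply: integrable_dominated => [|y].
    by apply: measurable_funM; [exact: mgauss|apply: measurable_funX; exact: mg].
  rewrite normrM ger0_norm ?expR_ge0// mulrC ler_wpM2r ?expR_ge0//.
  by rewrite normrX lerXn2r ?nnegrE ?(le_trans _ (gamB (y + t) j)) ?gamB.
(* After recentring at [t], the j-th part of the risk is the integral of [h j]. Stein's identity
   turns its cross term into a derivative, which gives [q j], and the squared coordinate contributes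
   one Gaussian mass. *)
pose h j (y : V) := gauss_rV 1 y * (y ord0 j - 0) ^+ 2 +
  (2 * (gauss_rV 1 y * (y ord0 j * g j y)) + gauss_rV 1 y * g j y ^+ 2).
pose q j (y : V) := 2 * (gauss_rV 1 y * g' j y) + gauss_rV 1 y * g j y ^+ 2.
have int2 j : mu.-integrable setT
    (EFin \o (fun y => 2 * (gauss_rV 1 y * (y ord0 j * g j y)))).
  by have [_ i _] := steinE j; exact: (integrableZl measurableT 2 i).
have int2' j : mu.-integrable setT (EFin \o (fun y => 2 * (gauss_rV 1 y * g' j y))).
  by have [i _ _] := steinE j; exact: (integrableZl measurableT 2 i).
have intr j := integrableD measurableT (int2 j) (intg2 j).
have intq j : mu.-integrable setT (EFin \o q j).
  exact: (integrableD measurableT (int2' j) (intg2 j)).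
have inth j : mu.-integrable setT (EFin \o h j).
  exact: (integrableD measurableT (gauss_affine_sqr 0 j ltr01).1 (intr j)).
have hE j : \int[mu]_y h j y = gauss_mass n 1 + \int[mu]_y q j y.
  rewrite (RintegralD measurableT (gauss_affine_sqr 0 j ltr01).1 (intr j)).
  rewrite (gauss_affine_sqr 0 j ltr01).2 divr1 expr0n/= mul0r addr0; congr (_ + _).
  rewrite (RintegralD measurableT (int2 j) (intg2 j)).
  rewrite (RintegralD measurableT (int2' j) (intg2 j)); congr (_ + _).
  have [i1 i2 e] := steinE j.
  by rewrite (RintegralZl _ measurableT i1) (RintegralZl _ measurableT i2) e mul1r.
have [intH HE] := Rintegral_sum (index_enum 'I_n) inth.
have [intQ QE] := Rintegral_sum (index_enum 'I_n) intq.
have Q0 : \int[mu]_y (\sum_j q j y) <= 0.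
  rewrite -oppr_ge0 -mulN1r -(RintegralZl _ measurableT intQ).
  apply: Rintegral_ge0 => y _; rewrite mulN1r oppr_ge0 big_split/=.
  rewrite -mulr_sumr -mulr_sumr -mulr_sumr mulrCA -mulrDr.
  by rewrite pmulr_rle0 ?expR_gt0//; exact: gam_le.
have -> : (risk t (fun x => x + \row_j gam x j)%R =
    \int[mu]_y (kappa * \sum_j h j y)%:E)%E.
  rewrite /risk -(integral_shift t); last first.
    apply/measurable_EFinP; apply: measurable_funM.
      apply: measurableT_comp; first exact: measurable_sqnorm.
      apply/measurable_fun_rVP => j; under eq_fun do rewrite !mxE.
      apply: measurable_funB => //; apply: measurable_funD; last exact: mgam.
      exact: measurable_coord.
    rewrite (_ : normal_rV_pdf t = (fun x => kappa * gauss_rV 1 (x - t))); last first.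
      by apply/funext => x; rewrite normal_rV_pdfE.
    apply: measurable_funM => //.
    exact: (measurableT_comp mgauss (measurable_addrV (- t))).
  apply: eq_integral => y _; congr EFin; rewrite normal_rV_pdfE addrK mulrCA.
  congr (_ * _); rewrite /sqnorm mulr_suml; apply: eq_bigr => j _.
  by rewrite !mxE /h /g; ring.
have intkH : mu.-integrable setT (EFin \o (fun y => kappa * \sum_j h j y)).
  exact: (integrableZl measurableT kappa intH).
rewrite (EFin_Rintegral intkH) lee_fin (RintegralZl _ measurableT intH).
rewrite ler_pM2l ?kappa_gt0// HE.
under eq_bigr do rewrite hE.
by rewrite big_split/= -QE sumr_const card_ord mulr_natl gerDl.
Qed.

End sure.

(** * Score of the mixture, its derivative and the resulting risk bound *)

Section mixture.
Context {R : realType}.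
Variables (d k : nat).
Local Notation V := 'rV[R]_d.
Local Notation kappa := ((2 * pi) `^ (- (d%:R / 2)) : R).

Lemma is_derive_sumf (h : 'I_k -> V -> R) (dh : 'I_k -> R) (x e : V) :
  (forall i, is_derive x e (h i) (dh i)) ->
  is_derive x e (fun y => \sum_i h i y) (\sum_i dh i).
Proof. by move=> dhE; rewrite -fct_sumE; exact: is_derive_sum. Qed.

(** The ratio F / M is kept inside the derivative because it will be a posterior weight. *)
Lemma is_derive_div (F M : V -> R) (dF dM : R) (x e : V) : M x != 0 ->
  is_derive x e F dF -> is_derive x e M dM ->
  is_derive x e (fun y => F y / M y) ((dF - F x / M x * dM) / M x).
Proof.
move=> M0 hF hM.
have hV : is_derive x e (fun y => (M y)^-1) (- (M x) ^- 2 *: dM).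
  have [dMx <-] := hM; apply: DeriveDef; first exact: derivableV.
  exact: deriveV.
have [i E] := is_deriveM hF hV.
split; first exact: i.
by apply: etrans E _; rewrite /GRing.scale/=; field.
Qed.

Variables (w : 'I_k -> R) (theta : 'I_k -> V) (g al : R -> R) (b c rho D T K : R).
Hypotheses (w_gt0 : forall i, 0 < w i) (w_sum1 : \sum_i w i = 1)
  (g_gt0 : forall q, 0 <= q -> 0 < g q)
  (mg : measurable_fun (`[0, +oo[ : set R) g)
  (mal : measurable_fun (`[0, +oo[ : set R) al)
  (g_der : forall (u : V) j, is_derive u (delta_mx ord0 j)
     (fun x => g (sqnorm x)) (- (g (sqnorm u) * radial_field al u j)))
  (al0 : al 0 = 0) (al_ge0 : forall q, 0 <= q -> 0 <= al q)
  (al_leK : forall q, 0 <= q -> al q <= K)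
  (al_noninc : forall s t, 0 < s -> s <= t -> al t <= al s)
  (qal_nondec : forall s t, 0 < s -> s <= t -> s * al s <= t * al t)
  (qal_le : forall q, 0 <= q -> q * al q <= b)
  (al_der : forall t, 0 < t -> derivable al t 1)
  (c_def : c = d%:R - 2) (c_gt0 : 0 < c) (rho_01 : 0 < rho < 1)
  (rho_le : rho * (2 * b - 2 * c) <= 2 * c - b)
  (theta_diam : forall i j, sqnorm (theta i - theta j) <= D)
  (T_gt0 : 0 < T) (alT : T * al T = c) (DT : D * (1 + rho^-1) ^+ 2 <= T).

Definition mixture_density (x : V) : R := \sum_i w i * g (sqnorm (x - theta i)).

Let p i x := w i * g (sqnorm (x - theta i)) / mixture_density x.
Let v i x j := radial_field al (x - theta i) j.
Let dv i x j := radial_field_partial al (x - theta i) j.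

(** The gradient of the logarithm of [mixture_density], called gam in the overview; [p i x] is the
    posterior weight of target [i]. *)
Definition mixture_score (x : V) j : R := - \sum_i p i x * v i x j.

Let dscore x j := \sum_i p i x * (v i x j ^+ 2 - dv i x j) - mixture_score x j ^+ 2.

Let wg_gt0 i x : 0 < w i * g (sqnorm (x - theta i)).
Proof. by rewrite mulr_gt0 ?g_gt0 ?sqnorm_ge0. Qed.

Lemma mixture_density_gt0 x : 0 < mixture_density x.
Proof.
have [i _|k0] := pickP (fun _ : 'I_k => true).
  rewrite /mixture_density (bigD1 i)//= ltr_pwDl//.
  by apply: sumr_ge0 => l _; exact: ltW.
by have := w_sum1; rewrite big_pred0// => /eqP; rewrite eq_sym oner_eq0.
Qed.

Let p_ge0 i x : 0 <= p i x.
Proof. by rewrite divr_ge0// ltW// mixture_density_gt0. Qed.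

Let p_sum1 x : \sum_i p i x = 1.
Proof. by rewrite -mulr_suml divff// gt_eqF// mixture_density_gt0. Qed.

Let wg_der i x j : is_derive x (delta_mx ord0 j)
  (fun x => w i * g (sqnorm (x - theta i)))
  (- (w i * g (sqnorm (x - theta i)) * v i x j)).
Proof.
have h := is_derive_translate (g_der (x - theta i) j).
by have := is_deriveZ (w i) h; rewrite /GRing.scale/= mulrN mulrA.
Qed.

Lemma mixture_density_der x j :
  is_derive x (delta_mx ord0 j) mixture_density (mixture_density x * mixture_score x j).
Proof.
have := is_derive_sumf (fun i => wg_der i x j).
rewrite (_ : \sum_i _ = mixture_density x * mixture_score x j)//.
rewrite /mixture_score mulrN mulr_sumr -sumrN; apply: eq_bigr => i _.
by rewrite /p; field; rewrite gt_eqF ?mixture_density_gt0.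
Qed.

Let p_der i x j : is_derive x (delta_mx ord0 j) (p i)
  (- (p i x * (v i x j + mixture_score x j))).
Proof.
have M0 : mixture_density x != 0 by rewrite gt_eqF ?mixture_density_gt0.
have := is_derive_div M0 (wg_der i x j) (mixture_density_der x j).
set D1 := (X in is_derive _ _ _ X -> _).
rewrite (_ : D1 = - (p i x * (v i x j + mixture_score x j)))//.
by rewrite /D1 /p; field.
Qed.

Let v_der i x j : is_derive x (delta_mx ord0 j) (fun x => v i x j) (dv i x j).
Proof.
apply: (@is_derive_translate _ _ (radial_field al ^~ j)).
exact: (radial_field_is_derive al_ge0 al_leK al_noninc al_der).
Qed.

(** Differentiating p_i v_i brings out p_i (v_i + gam_j) v_i by [p_der]; the terms p_i v_i gam_j sum
    to - gam_j^2. *)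
Let score_der x j : is_derive x (delta_mx ord0 j) (mixture_score ^~ j) (dscore x j).
Proof.
have h i : is_derive x (delta_mx ord0 j) (fun x => p i x * v i x j)
    (p i x * dv i x j - p i x * (v i x j + mixture_score x j) * v i x j).
  have [hm E] := is_deriveM (p_der i x j) (v_der i x j).
  split; first exact: hm.
  by apply: etrans E _; rewrite /GRing.scale/=; ring.
have := is_deriveN (is_derive_sumf h).
set D1 := (X in is_derive _ _ _ X -> _).
rewrite (_ : D1 = dscore x j)// /D1 /dscore.
have -> : mixture_score x j ^+ 2 = \sum_i - (p i x * v i x j * mixture_score x j).
  by rewrite sumrN -mulr_suml -mulNr expr2.
by rewrite -sumrN -sumrB; apply: eq_bigr => i _; ring.
Qed.

Let convex_le (z : 'I_k -> R) (C : R) x :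
  (forall i, `|z i| <= C) -> `|\sum_i p i x * z i| <= C.
Proof.
move=> zC; rewrite (le_trans (ler_norm_sum _ _ _))//.
rewrite -[leRHS]mul1r -(p_sum1 x) mulr_suml; apply: ler_sum => i _.
by rewrite normrM ger0_norm// ler_wpM2l.
Qed.

Let K_ge0 : 0 <= K.
Proof. by apply: le_trans (al_leK (lexx 0)); rewrite al0. Qed.

Let v_sqr_le i x j : v i x j ^+ 2 <= K * b.
Proof.
rewrite (le_trans (radial_field_sqr_le al_ge0 al_leK _ _))// ler_wpM2l//.
exact: qal_le (sqnorm_ge0 _).
Qed.

Let score_le x j : `|mixture_score x j| <= 1 + K * b.
Proof.
rewrite normrN; apply: convex_le => i.
(* The bound 1 + K b comes from |z| <= 1 + z^2. *)
have := v_sqr_le i x j; rewrite -real_normK ?num_real//.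
have := normr_ge0 (v i x j); nra.
Qed.

Let dscore_le x j : `|dscore x j| <= K * b + K + (1 + K * b) ^+ 2.
Proof.
rewrite (le_trans (ler_normB _ _))// lerD//.
  apply: convex_le => i; rewrite (le_trans (ler_normB _ _))// lerD//.
    by rewrite ger0_norm ?sqr_ge0.
  exact: (radial_field_partial_le al_ge0 al_leK al_noninc qal_nondec al_der).
rewrite ger0_norm ?sqr_ge0// -real_normK ?num_real//.
by rewrite lerXn2r ?nnegrE ?(le_trans (normr_ge0 _) (score_le x j)).
Qed.

(** The divergence contains - |gam|^2; doubled and added to |gam|^2 it leaves one - |gam|^2, which
    compensates the remaining terms by [mixture_pointwise_le]. *)
Let dscore_sum_le x : 2 * (\sum_j dscore x j) + \sum_j mixture_score x j ^+ 2 <= 0.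
Proof.
have diam i j : sqnorm ((x - theta i) - (x - theta j)) <= D.
  by rewrite opprB addrC addrA subrK; exact: theta_diam.
have main := mixture_pointwise_le (p_ge0 ^~ x) (p_sum1 x) al_ge0 al_noninc qal_nondec
  qal_le c_gt0 rho_01 rho_le diam T_gt0 alT DT.
have scE : \sum_j mixture_score x j ^+ 2 =
    \sum_(j < d) (\sum_i p i x * (al (sqnorm (x - theta i)) * (x - theta i) ord0 j)) ^+ 2.
  by apply: eq_bigr => j _; rewrite sqrrN.
have divE : \sum_j dscore x j <=
    \sum_i p i x * (sqnorm (x - theta i) * al (sqnorm (x - theta i)) ^+ 2 -
      c * al (sqnorm (x - theta i))) - \sum_j mixture_score x j ^+ 2.
  rewrite sumrB lerD2r exchange_big/=; apply: ler_sum => i _.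
  rewrite -mulr_sumr ler_wpM2l// sumrB lerB//.
    rewrite le_eqVlt; apply/orP; left; apply/eqP.
    rewrite [in RHS]mulrC /sqnorm mulr_sumr; apply: eq_bigr => j _.
    by rewrite /v /radial_field exprMn.
  by rewrite c_def; exact: (radial_field_div_ge al0 al_ge0 al_leK al_noninc qal_nondec al_der).
by move: divE; rewrite /= in main; rewrite scE; lra.
Qed.

Let measurable_score j : measurable_fun setT (mixture_score ^~ j).
Proof.
have msq i : measurable_fun setT (fun x : V => sqnorm (x - theta i)).
  exact: (measurableT_comp (@measurable_sqnorm R d) (measurable_addrV _)).
have mcomp (h : R -> R) i : measurable_fun (`[0, +oo[ : set R) h ->
    measurable_fun setT (fun x : V => h (sqnorm (x - theta i))).
  move=> mh; apply: measurable_comp mh (msq i) => //.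
  by move=> _ [y _ <-]; rewrite /= in_itv/= sqnorm_ge0.
have mdens : measurable_fun setT mixture_density.
  by apply: measurable_sum => i; apply: measurable_funM => //; exact: mcomp.
apply: measurableT_comp => //; apply: measurable_sum => i.
apply: measurable_funM.
  apply: measurable_funM; first by apply: measurable_funM => //; exact: mcomp.
  (* Inversion is measurable on the positive reals, where it is continuous and where the density
     takes its values. *)
  have cV : {in [set r : R | 0 < r], continuous (@GRing.inv R)}.
    by move=> r /[!inE] r0; apply: inv_continuous; rewrite gt_eqF.
  have oP : open [set r : R | 0 < r] by exact: open_gt.
  apply: measurable_comp (open_continuous_measurable_fun oP cV) mdens.
    exact: open_measurable.
  by move=> _ [x _ <-]; exact: mixture_density_gt0.
apply: measurable_funM; first exact: mcomp.
exact: (measurableT_comp (measurable_coord j) (measurable_addrV _)).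
Qed.

Lemma mixture_risk_le t :
  measurable_fun setT (fun x : V => x + \row_j mixture_score x j) /\
  (risk t (fun x => x + \row_j mixture_score x j)%R <=
   (kappa * (d%:R * gauss_mass d 1))%:E)%E.
Proof.
split; last exact: (sure_risk_le t measurable_score score_der score_le dscore_le dscore_sum_le).
apply/measurable_fun_rVP => j; under eq_fun do rewrite !mxE.
by apply: measurable_funD; [exact: measurable_coord|exact: measurable_score].
Qed.

End mixture.

(** * Growth of the shrinkage factor and its inverse *)

Section shrinkage_factor_profile.
Context {R : realType}.
Variable f : R -> R.
Local Notation r := (shrinkage_factor f).
Hypotheses (f_gt0 : forall t, 0 <= t -> 0 < f t)
  (f_der : forall t, 0 < t -> derivable f t 1)
  (f_expR : forall s t, 0 <= s -> s <= t -> f s * expR (s / 2) <= f t * expR (t / 2))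
  (r_der : forall t : R, 0 < t -> derivable r t 1 /\ 0 < derive1 r t)
  (r_ge0 : forall t, 0 <= t -> 0 <= r t).

Lemma derivable_pos_measurable (h : R -> R) : (forall t, 0 < t -> derivable h t 1) ->
  measurable_fun (`[0, +oo[ : set R) h.
Proof.
move=> dh; rewrite (_ : `[0, +oo[%classic = [set 0] `|` [set t : R | 0 < t]).
  have oP : open [set t : R | 0 < t] by exact: open_gt.
  apply/measurable_funU => //; first exact: open_measurable.
  split; first exact: measurable_fun_set1.
  apply: open_continuous_measurable_fun => // t /[!inE] t0.
  exact/differentiable_continuous/derivable1_diffP/dh.
apply/seteqP; split=> t /=; rewrite in_itv/= andbT.
  by rewrite le_eqVlt => /predU1P[<-|]; [left|right].
by move=> [->//|/ltW].
Qed.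

Lemma shrinkage_factor0 : r 0 = 0.
Proof. by rewrite /shrinkage_factor mulr0 !mul0r. Qed.

Lemma shrinkage_factor_derive1 t : 0 < t -> derive1 f t = - (r t * f t / (2 * t)).
Proof.
move=> t0; have ft := f_gt0 (ltW t0).
by rewrite /shrinkage_factor; field; rewrite !gt_eqF.
Qed.

(* By Tweedie's formula the derivative of [log (f t * expR (t / 2))] is a
   positive multiple of the posterior mean of [theta] along [x], where [t = |x|^2]. *)
Lemma shrinkage_factor_le_id t : 0 < t -> r t <= t.
Proof.
move=> t0; have ft := f_gt0 (ltW t0).
have df : is_derive t (1 : R) f (derive1 f t).
  by rewrite derive1E; apply: DeriveDef => //; exact: f_der.
have dE : is_derive t (1 : R) (fun t : R => expR (t / 2)) (expR (t / 2) / 2).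
  by apply: is_derive_eq; rewrite /GRing.scale/=; field.
have dM := is_deriveM df dE.
have := nondecreasing_derive_ge0 t0 dM (fun s u s0 => f_expR (ltW s0)).
rewrite /GRing.scale/= shrinkage_factor_derive1//.
rewrite (_ : _ + _ = expR (t / 2) * f t / (2 * t) * (t - r t)); last first.
  by field; rewrite gt_eqF.
by rewrite pmulr_rge0 ?subr_ge0// divr_gt0 ?mulr_gt0 ?expR_gt0.
Qed.

Lemma shrinkage_factor_lt s t : 0 < s -> s < t -> r s < r t.
Proof.
move=> s0 st.
have pos x : x \in `]s, t[ -> 0 < x by rewrite in_itv/= => /andP[sx _]; exact: lt_trans sx.
apply: (@gtr0_derive1_incr _ r s t) => //.
- by move=> x /pos x0; have [] := r_der x0.
- by move=> x /pos x0; have [] := r_der x0.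
- apply: derivable_within_continuous => x; rewrite in_itv/= => /andP[sx _].
  by have [] := r_der (lt_le_trans s0 sx).
Qed.

Lemma shrinkage_factor_le s t : 0 < s -> s <= t -> r s <= r t.
Proof.
by move=> s0; rewrite le_eqVlt => /predU1P[->//|st]; exact/ltW/shrinkage_factor_lt.
Qed.

(** The intermediate value theorem produces a preimage of [c], and strict monotonicity on [0, +oo[
    makes it the one that [inverse_nneg] returns. *)
Lemma inverse_shrinkage_factor (b c : R) :
  b = sup [set r t | t in (`[0, +oo[ : set R)] -> 0 < c < b ->
  0 < inverse_nneg r c /\ r (inverse_nneg r c) = c.
Proof.
move=> bE /andP[c0 cb].
(* [c] lies below the supremum, so some value exceeds it, and not at 0, where [r] vanishes. *)
have [t t0 rt] : exists2 t, 0 < t & c < r t.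
  have : [set r t | t in (`[0, +oo[ : set R)] !=set0.
    by exists (r 0); exists 0 => //=; rewrite in_itv/= lexx.
  rewrite bE in cb => ne; have [_ [t /= t0 <-] ct] := sup_gt ne cb.
  exists t => //; move: t0; rewrite in_itv/= andbT le_eqVlt => /predU1P[t0|//].
  by move: ct; rewrite -t0 shrinkage_factor0 ltNge (ltW c0).
(* A positive left endpoint: r(s) <= s <= c, so continuity of [r] at 0 is never invoked. *)
pose s := Num.min c t.
have s0 : 0 < s by rewrite lt_min c0.
have st : s <= t by rewrite ge_min lexx orbT.
have rs : r s <= c by rewrite (le_trans (shrinkage_factor_le_id s0))// ge_min lexx.
have cr : {within `[s, t], continuous r}.
  apply: derivable_within_continuous => x; rewrite in_itv/= => /andP[sx _].
  by have [] := r_der (lt_le_trans s0 sx).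
have [|u] := IVT (v := c) st cr.
  by rewrite ge_min rs le_max (ltW rt) orbT.
rewrite in_itv/= => /andP[su _] ru; have u0 := lt_le_trans s0 su.
suff -> : inverse_nneg r c = u by [].
have r_pos x : 0 < x -> 0 < r x.
  move=> x0; have x2 : 0 < x / 2 by lra.
  by rewrite (le_lt_trans (r_ge0 (ltW x2)))// shrinkage_factor_lt//; lra.
rewrite -ru /inverse_nneg; apply: pinvKV; last by rewrite inE/= in_itv/= ltW.
suff lt_inj x y : 0 <= x -> x < y -> r x < r y.
  move=> x y /[!inE]/= /[!in_itv]/= /[!andbT] x0 y0 rxy.
  have [xy|yx|//] := ltgtP x y.
    by have := lt_inj _ _ x0 xy; rewrite rxy ltxx.
  by have := lt_inj _ _ y0 yx; rewrite rxy ltxx.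
rewrite le_eqVlt => /predU1P[<-|x0 xy]; last exact: shrinkage_factor_lt.
by rewrite shrinkage_factor0 => /r_pos.
Qed.

End shrinkage_factor_profile.

(** * Rescaling by [a] and matching of the two risk bounds *)

Theorem theorem3 (R : realType) (d k : nat) (prior f : R -> R)
    (theta : 'I_k -> 'rV[R]_d) (w : 'I_k -> R) (b rho a : R)
    (prior_ge0 : forall t : R, 0 <= t -> 0 <= prior t)
    (prior_meas : measurable_fun (`[0, +oo[ : set R) prior)
    (marginal_fin : forall x : 'rV[R]_d, (0 < marginal prior x < +oo)%E)
    (marginal_f : forall x : 'rV[R]_d, marginal prior x = (f (sqnorm x))%:E)
    (theta_inj : injective theta)
    (w_gt0 : forall i, 0 < w i)
    (w_sum1 : \sum_(i < k) w i = 1)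
    (r_deriv : forall t : R, 0 < t ->
      derivable (shrinkage_factor f) t 1 /\ 0 < derive1 (shrinkage_factor f) t)
    (r_bounds : forall t : R, 0 <= t -> 0 <= shrinkage_factor f t <= b)
    (b_sup : b = sup [set shrinkage_factor f t | t in (`[0, +oo[ : set R)])
    (b_bounds : d%:R - 2 < b < 2 * (d%:R - 2))
    (r_div : forall s t : R, 0 < s -> s <= t ->
      shrinkage_factor f t / t <= shrinkage_factor f s / s)
    (rho_01 : 0 < rho < 1)
    (rho_le : rho <= (2 * (d%:R - 2) - b) / (2 * b - 2 * (d%:R - 2)))
    (a_gt0 : 0 < a)
    (a_ge : max_sqdist theta / inverse_nneg (shrinkage_factor f) (d%:R - 2)
              * (1 + rho^-1) ^+ 2 <= a) :
  minimax (multiple_shrinkage w theta f a).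
Proof.
pose r := shrinkage_factor f; pose c : R := d%:R - 2; pose ts := inverse_nneg r c.
have /andP[cb b2c] := b_bounds; have c0 : 0 < c by rewrite /c; lra.
(* As d - 2 > 0 there is a coordinate axis along which the marginal can be studied. *)
have d_gt0 : (0 < d)%N by rewrite lt0n; apply: contraTneq c0 => d0; rewrite /c d0 -leNgt; lra.
pose j0 : 'I_d := Ordinal d_gt0.
have f_gt0 t : 0 <= t -> 0 < f t by exact: (radial_gt0 j0 marginal_fin marginal_f).
have f_der t : 0 < t -> derivable f t 1.
  exact: (radial_derivable j0 prior_ge0 prior_meas marginal_fin marginal_f).
have f_der0 := radial_sqr_derive0 j0 prior_ge0 prior_meas marginal_fin marginal_f.
have f_expR s t : 0 <= s -> s <= t -> f s * expR (s / 2) <= f t * expR (t / 2).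
  exact: (radial_expR_nondecreasing j0 prior_ge0 prior_meas marginal_fin marginal_f).
have r_ge0 t : 0 <= t -> 0 <= r t by move=> /r_bounds /andP[].
have r_le_b t : 0 <= t -> r t <= b by move=> /r_bounds /andP[].
have r_nondec := shrinkage_factor_le r_deriv.
have [ts0 rts] : 0 < ts /\ r ts = c.
  by apply: (inverse_shrinkage_factor f_gt0 f_der f_expR r_deriv r_ge0 b_sup); rewrite c0.
pose C := a `^ (- (d%:R / 2)); have C0 : 0 < C by rewrite powR_gt0.
(* The shrinkage factor of [g] at [q] is r(q / a), and the logarithmic gradient of g(|u|^2) is -
   al(|u|^2) u. Division by zero makes [al 0] equal to 0. *)
pose g := rescaled d a f; pose al q := r (q / a) / q.
have qa q : 0 < q -> 0 < q / a by move=> q0; rewrite divr_gt0.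
have qa0 q : 0 <= q -> 0 <= q / a by move=> q0; apply: divr_ge0 => //; exact: ltW.
have qal q : 0 < q -> q * al q = r (q / a).
  by move=> q0; rewrite /al mulrC divfK ?gt_eqF.
have alE q : al q = r (q / a) / (q / a) / a.
  by rewrite /al invf_div -mulrA [a / q / a]mulrAC divff ?gt_eqF// mul1r.
have g_gt0 q : 0 <= q -> 0 < g q by move=> /qa0 /f_gt0; exact: mulr_gt0.
have al0 : al 0 = 0 by rewrite /al invr0 mulr0.
have al_ge0 q : 0 <= q -> 0 <= al q by move=> q0; rewrite divr_ge0 ?r_ge0 ?qa0.
(* This is r(t) <= t at t = q / a. *)
have al_leK q : 0 <= q -> al q <= a^-1.
  rewrite le_eqVlt => /predU1P[<-|q0]; first by rewrite al0 invr_ge0 ltW.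
  rewrite ler_pdivrMr// [leRHS]mulrC.
  exact: (shrinkage_factor_le_id f_gt0 f_der f_expR (qa _ q0)).
have al_noninc s t : 0 < s -> s <= t -> al t <= al s.
  move=> s0 st; rewrite !alE ler_pM2r ?invr_gt0//.
  by apply: r_div; [exact: qa|rewrite ler_pM2r ?invr_gt0].
have qal_nondec s t : 0 < s -> s <= t -> s * al s <= t * al t.
  move=> s0 st; rewrite !qal ?(lt_le_trans s0)//.
  by apply: r_nondec; [exact: qa|rewrite ler_pM2r ?invr_gt0].
have qal_le q : 0 <= q -> q * al q <= b.
  rewrite le_eqVlt => /predU1P[<-|q0]; first by rewrite mul0r; lra.
  by rewrite qal ?r_le_b ?qa0 ?ltW.
have da (t : R) : is_derive t (1 : R) (fun q => q / a) a^-1.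
  by apply: is_derive_eq; rewrite /GRing.scale/=; ring.
have al_der (t : R) : 0 < t -> derivable al t 1.
  move=> t0; have dr : is_derive (t / a : R) (1 : R) r ('D_1 r (t / a)).
    by apply: DeriveDef; have [] := r_deriv _ (qa _ t0).
  have t_neq0 : (id : R -> R) t != 0 by rewrite gt_eqF.
  have [dra _] := @is_derive1_comp _ r (fun q => q / a) t _ _ dr (da t).
  exact: (derivableM dra (derivableV t_neq0 (@derivable_id _ _ t 1))).
have g_der1 (t : R) : 0 < t -> is_derive t (1 : R) g (- (g t * al t / 2)).
  move=> t0; have df : is_derive (t / a : R) (1 : R) f (derive1 f (t / a)).
    by rewrite derive1E; apply: DeriveDef => //; exact: f_der (qa _ t0).
  have := is_deriveZ C (@is_derive1_comp _ f (fun q => q / a) t _ _ df (da t)).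
  set D := (X in is_derive _ _ _ X -> _); rewrite (_ : D = - (g t * al t / 2))//.
  rewrite /D /GRing.scale/= (shrinkage_factor_derive1 f_gt0 (qa _ t0)).
  by rewrite /g /rescaled -/C /al -/r; field; rewrite !gt_eqF.
have g_der (u : 'rV[R]_d) j : is_derive u (delta_mx ord0 j)
    (fun x => g (sqnorm x)) (- (g (sqnorm u) * radial_field al u j)).
  have [u0|u0] := eqVneq u 0; last first.
    have q0 : 0 < sqnorm u by rewrite lt_def sqnorm_eq0 u0 sqnorm_ge0.
    have := radial_is_derive j q0 (g_der1 _ q0).
    set D := (X in is_derive _ _ _ X -> _).
    rewrite (_ : D = - (g (sqnorm u) * radial_field al u j))//.
    by rewrite /D /radial_field; field.
  (* At the origin the profile is handled through g(s^2) = C f((s / sqrt a)^2), whose derivative at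
     0 vanishes. *)
  rewrite u0 /radial_field mxE mulr0 mulr0 oppr0; apply: radial_is_derive0.
  pose sa := Num.sqrt a.
  have dsa : is_derive (0 : R) (1 : R) (fun s => s / sa) sa^-1.
    by apply: is_derive_eq; rewrite /GRing.scale/=; ring.
  have df0 : is_derive ((0 : R) / sa) (1 : R) (fun s => f (s ^+ 2)) 0 by rewrite mul0r.
  have := is_deriveZ C (@is_derive1_comp _ (fun s => f (s ^+ 2)) (fun s => s / sa) 0 _ _ df0 dsa); rewrite mul0r scaler0.
  rewrite (_ : C \*: _ = (fun s => g (s ^+ 2)))//; apply/funext => s /=.
  by rewrite /g /rescaled -/C expr_div_n sqr_sqrtr ?ltW.
have mal : measurable_fun (`[0, +oo[ : set R) al by exact: derivable_pos_measurable.
have mg : measurable_fun (`[0, +oo[ : set R) g.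
  by apply: derivable_pos_measurable => t /g_der1 [].
have diam i l : sqnorm (theta i - theta l) <= max_sqdist theta.
  (* The maximum runs over distinct indices; for equal ones its default 0 makes it nonnegative,
     which suffices. *)
  have [->|il] := eqVneq i l.
    rewrite subrr (_ : sqnorm 0 = 0); last by apply/eqP; rewrite sqnorm_eq0.
    by rewrite /max_sqdist; elim/big_ind: _ => // [x y x0 y0|p _];
      rewrite ?le_max ?x0 ?sqnorm_ge0.
  exact: (@le_bigmax_cond _ _ _ _ (i, l)
    (fun p : 'I_k * 'I_k => p.1 != p.2) (fun p => sqnorm (theta p.1 - theta p.2))).
(* The critical squared radius T = a r^-1(d - 2), where the rescaled factor equals d - 2. The
   hypothesis on [a] becomes D (1 + 1/rho)^2 <= T. *)
have T0 : 0 < a * ts by exact: mulr_gt0.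
have alT : a * ts * al (a * ts) = c by rewrite qal// mulrAC divff ?gt_eqF// mul1r.
have DT : max_sqdist theta * (1 + rho^-1) ^+ 2 <= a * ts.
  by rewrite -ler_pdivrMr// mulrAC.
have rho_le' : rho * (2 * b - 2 * c) <= 2 * c - b.
  by rewrite -ler_pdivlMr//; rewrite /c; lra.
have risk_le t := mixture_risk_le w_gt0 w_sum1 g_gt0 mg mal g_der al0 al_ge0 al_leK
  al_noninc qal_nondec qal_le al_der (erefl c) c0 rho_01 rho_le' diam T0 alT DT t.
have deltaE : multiple_shrinkage w theta f a =
    (fun x => x + \row_j mixture_score w theta g al x j).
  apply/funext => x; rewrite /multiple_shrinkage; congr (x + _); apply/rowP => j.
  have [_ DE] := mixture_density_der theta w_gt0 w_sum1 g_gt0 g_der x j.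
  rewrite !mxE; apply: (canLR (mulKf _)); last exact: DE.
  by rewrite gt_eqF//; exact: (mixture_density_gt0 theta w_gt0 w_sum1 g_gt0).
rewrite deltaE; split; first by have [] := risk_le 0.
(* The common value of the two risk bounds separates the supremum risk here from that of every
   estimator. The other inequality holds because the shrinkage rule is itself an estimator. *)
apply/eqP; rewrite eq_le; apply/andP; split.
  apply: le_trans (_ : (_ <= ((2 * pi) `^ (- (d%:R / 2)) * (d%:R * gauss_mass d 1))%:E)%E) _.
    by apply: ge_ereal_sup => _ [t _ <-]; have [] := risk_le t.
  by apply: le_ereal_inf_tmp => _ [delta mdelta <-]; exact: sup_risk_ge.
by apply: ereal_inf_lbound; exists (fun x => x + \row_j mixture_score w theta g al x j) => //;
  have [] := risk_le 0.
Qed.
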